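(* Let $\mathcal G$ be a real Markov topograph with labels in $(-\infty,-2]\cup[2,\infty)$ with a negative vertex well $v$ (so that its discriminator satisfies $D\ge20$). Use a Farey indexing in which $v$ is the central vertex where the regions with indices $0/1$, $1/1$ and $1/0$ meet. Then $P_{\mathcal G}$ extends uniquely to a polar curve about the origin. This curve is $\Gamma_{\mathcal G}$ and it has six piecewise concave parts (lying between consecutive lines through the origin of slopes $0/1$, $1/1$, $1/0$). It is continuous except at slopes corresponding to a region with label $-2$ at $v$, where the curve goes to infinity.
   Context: A real Markov topograph $\mathcal G$ is an infinite 3-regular tree drawn in the plane, with a real label on every complementary region, such that for every edge, with regions $s,t$ on its two sides and regions $r,u$ at its two ends, $r+u=st$. The discriminator is $D=r^2+s^2+t^2-rst$ for the labels meeting at a vertex (independent of the vertex). A negative vertex well is a vertex whose three neighbouring regions all have labels $\le-2$. Farey indexing: regions are indexed by $\mathbb P^1(\mathbb Q)$, elements written $k/n$ with $\gcd(k,n)=1$, $k/n=(-k)/(-n)$, including $1/0$. Here the three regions at $v$ in clockwise order are $(s,u,t)$ and $m^*_{1/0}=s$, $m^*_{1/1}=u$, $m^*_{0/1}=t$; if $k/n,k'/n'$ index the two regions on the sides of an edge then the regions at its ends have indices $(k+k')/(n+n')$ and $(k-k')/(n-n')$. $m^*_{k/n}$ is the label of region $k/n$; set $r=m^*_{-1/1}=st-u$. Let $\rho(x)=\cosh^{-1}(x/2)$ for $x\ge2$ and $$P_{\mathcal G}=\left\{\left(\frac n{\rho(|m^*_{k/n}|)},\frac k{\rho(|m^*_{k/n}|)}\right):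 k,n\in\mathbb Z,\ \gcd(k,n)=1\right\},$$ where points with $\rho(|m^*_{k/n}|)=0$ are regarded as at infinity in the given direction. For $k/n\in\mathbb Q\cap[0,1]$ in lowest terms ($n\ge1$) put $\phi_0(k/n)=\rho(|m^*_{n/k}|)/n$, $\phi_1(k/n)=\rho(|m^*_{k/n}|)/n$, $\phi_2(k/n)=\rho(|m^*_{-k/n}|)/n$, $\phi_3(k/n)=\rho(|m^*_{-n/k}|)/n$ (with $m^*_{n/k}=m^*_{-n/k}=m^*_{1/0}$ when $k/n=0/1$). These extend uniquely to continuous functions $\Phi_0,\dots,\Phi_3$ on $[0,1]$ (the encoding functions of the Markov trees with base triples $(s,su-t,u)$, $(t,ut-s,u)$, $(t,rt-s,r)$, $(s,rs-t,r)$ respectively, after sign changes making the labels positive). The lattice curve is $$\Gamma_{\mathcal G}=\pm\left\{\frac{(x,1)}{\Phi_0(x)},\ \frac{(1,x)}{\Phi_1(x)},\ \frac{(-1,x)}{\Phi_2(x)},\ \frac{(x,-1)}{\Phi_3(x)} : x\in[0,1]\right\},$$ omitting points where the denominator is $0$. A polar curve about the origin is a set of points $R(\theta)(\cos\theta,\sin\theta)$, with $R(\theta)\in(0,\infty]$ and points with $R(\theta)=\infty$ at infinity; uniqueness of the extension is among $R:\mathbb R/2\pi\mathbb Z\to(0,\infty]$ that are continuous as maps into $(0,\infty]$. A part of a polar curve is concave if it bulges towards the origin (any secant cuts off a piece of the curve lying on the same side of the secant as the origin). *)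

(* Defs.v *)
From mathcomp Require Import all_boot all_order all_algebra.
From mathcomp Require Import all_classical all_reals all_analysis.
From mathcomp Require Import ring lra.

Set Implicit Arguments.
Unset Strict Implicit.
Unset Printing Implicit Defensive.

Import Order.TTheory GRing.Theory Num.Theory.
Import numFieldNormedType.Exports.

Local Open Scope classical_set_scope.
Local Open Scope ring_scope.

(* An infinite 3-regular tree drawn in the plane, given by its oriented edges
   ("darts").  [rev] reverses a dart and [rot] turns it counterclockwise to the
   next dart leaving the same vertex, so that a vertex is an orbit of [rot].
   [left d] is the complementary region on the left of [d]; the region on its
   right is [left (rev d)].  Walking along [d] with the region [left d] at the
   left hand, the next dart on the boundary of that region is
   [rot (rot (rev d))], i.e. [rev d] turned clockwise. *)
Record plane_cubic_tree := PlaneCubicTree {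
  dart : Type;
  rev : dart -> dart;
  rot : dart -> dart;
  region : Type;
  left : dart -> region;
  revK : involutive rev;
  rev_neq : forall d, rev d <> d;
  rot3 : forall d, rot (rot (rot d)) = d;
  rot_neq : forall d, rot d <> d;
  tree_connected : forall d d', exists w : seq bool,
    d' = foldl (fun e b => if b then rev e else rot e) d w;
  (* a nonempty non-backtracking walk (left or right turn at every vertex)
     never comes back to its initial dart *)
  tree_acyclic : forall d (w : seq bool), w <> [::] ->
    foldl (fun e b => if b then rot (rev e) else rot (rot (rev e))) d w <> d;
  left_surj : forall x, exists d, left d = x;
  left_eq : forall d d', left d = left d' <->
    exists j : nat, d' = iter j (fun e => rot (rot (rev e))) d \/
                    d = iter j (fun e => rot (rot (rev e))) d' }.

Arguments rev {p} _.
Arguments rot {p} _.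
Arguments left {p} _.

(* The regions on the two sides of [d] are [left d] and [left (rev d)], those
   at its two ends are [left (rot d)] and [left (rot (rev d))]. *)
Record markov_topograph (R : realType) := MarkovTopograph {
  tree :> plane_cubic_tree;
  label : region tree -> R;
  edge_rule : forall d : dart tree,
    label (left (rot d)) + label (left (rot (rev d))) =
    label (left d) * label (left (rev d)) }.

Section Topograph.
Variables (R : realType) (G : markov_topograph R).

(* [d] stands for the vertex that it leaves. *)
Definition discriminator (d : dart G) : R :=
  let r := label (left d) in
  let s := label (left (rot d)) in
  let t := label (left (rot (rot d))) in
  r ^+ 2 + s ^+ 2 + t ^+ 2 - r * s * t.

Definition negative_vertex_well (d : dart G) : Prop :=
  [/\ label (left d) <= -2, label (left (rot d)) <= -2 &
      label (left (rot (rot d))) <= -2].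

End Topograph.

(* [f k n] is the region with index k/n, and is meaningful only for k, n
   coprime; this makes [f] a bijection from P^1(Q) onto the regions. *)
Definition has_index (T : plane_cubic_tree) (f : int -> int -> region T)
    (x : region T) (k n : int) : Prop :=
  coprimez k n /\ x = f k n.

Record farey_indexing (T : plane_cubic_tree) (f : int -> int -> region T) :
    Prop := FareyIndexing {
  farey_opp : forall k n, coprimez k n -> f (- k) (- n) = f k n;
  farey_inj : forall k n k' n', coprimez k n -> coprimez k' n' ->
    f k n = f k' n' -> (k = k' /\ n = n') \/ (k = - k' /\ n = - n');
  farey_surj : forall x, exists k n, has_index f x k n;
  farey_edge : forall (d : dart T) k n k' n',
    has_index f (left d) k n -> has_index f (left (rev d)) k' n' ->
    (has_index f (left (rot d)) (k + k') (n + n') /\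
     has_index f (left (rot (rev d))) (k - k') (n - n')) \/
    (has_index f (left (rot d)) (k - k') (n - n') /\
     has_index f (left (rot (rev d))) (k + k') (n + n')) }.

(* The vertex that [d] leaves is the central one, with 1/0, 1/1, 0/1 in
   clockwise order; [rot] being counterclockwise, these regions are met in the
   order 0/1, 1/1, 1/0 when [d] is turned. *)
Definition centred_at (T : plane_cubic_tree) (f : int -> int -> region T)
    (d : dart T) : Prop :=
  [/\ left d = f 0 1, left (rot d) = f 1 1 & left (rot (rot d)) = f 1 0].

Section Hyperbolic.
Variable R : realType.

Definition cosh (y : R) : R := (expR y + expR (- y)) / 2.

Definition arccosh (x : R) : R := ln (x + Num.sqrt (x ^+ 2 - 1)).

Lemma arccosh_ge0 x : 1 <= x -> 0 <= arccosh x.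
Proof.
move=> x1; apply: ln_ge0.
by have := sqrtr_ge0 (x ^+ 2 - 1); lra.
Qed.

Lemma arccoshK x : 1 <= x -> cosh (arccosh x) = x.
Proof.
move=> x1; rewrite /cosh /arccosh expRN.
have y0 := sqrtr_ge0 (x ^+ 2 - 1).
have y2 : Num.sqrt (x ^+ 2 - 1) ^+ 2 = x ^+ 2 - 1 by rewrite sqr_sqrtr//; nra.
set y := Num.sqrt _ in y0 y2 *.
have p : 0 < x + y by lra.
rewrite lnK ?posrE//.
have -> : (x + y)^-1 = x - y.
  apply: (mulfI (lt0r_neq0 p)); rewrite divff ?lt0r_neq0//.
  by rewrite mulrC -subr_sqr y2; ring.
by field.
Qed.

Definition rho (x : R) : R := arccosh (x / 2).

End Hyperbolic.

(* The plane with a point at infinity added in each direction, a direction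
   being a unit vector. *)
Inductive explane (R : realType) :=
  | Affine of R * R
  | AtInfinity of R * R.

Section PolarCurves.
Variable R : realType.

(* Only used with radii in (0, +oo]. *)
Definition polar_point (r : \bar R) (theta : R) : explane R :=
  if r is r'%:E then Affine (r' * cos theta, r' * sin theta)
  else AtInfinity (cos theta, sin theta).

Definition polar_curve (rad : R -> \bar R) : set (explane R) :=
  [set polar_point (rad theta) theta | theta in [set: R]].

(* Continuous maps from R / 2 pi Z to (0, +oo]. *)
Definition polar_radius (rad : R -> \bar R) : Prop :=
  [/\ forall theta, (0 < rad theta)%E,
      forall theta, rad (theta + 2 * pi) = rad theta &
      continuous rad].

(* Sign of the side of the line (pq) on which x lies. *)
Definition side (p q x : R * R) : R :=
  (q.1 - p.1) * (x.2 - p.2) - (q.2 - p.2) * (x.1 - p.1).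

Definition same_side (p q x y : R * R) : Prop := 0 < side p q x * side p q y.

(* The part of the curve with angles in [a, b]: the piece cut off by any secant
   is on the same side of it as the origin. *)
Definition concave_part (rad : R -> \bar R) (a b : R) : Prop :=
  forall (theta1 theta theta2 : R) (p q : R * R),
    a <= theta1 -> theta1 < theta -> theta < theta2 -> theta2 <= b ->
    polar_point (rad theta1) theta1 = Affine p ->
    polar_point (rad theta2) theta2 = Affine q ->
    exists2 x, polar_point (rad theta) theta = Affine x &
      same_side p q x (0, 0).

(* Angles of the rays of slopes 0/1, 1/1 and 1/0, in increasing order. *)
Definition sector_angles : seq R :=
  [:: 0; pi / 4; pi / 2; pi; pi + pi / 4; pi + pi / 2; 2 * pi].

Definition has_slope (theta : R) (k n : int) : Prop :=
  sin theta * n%:~R = cos theta * k%:~R.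

End PolarCurves.

Section Lattice.
Variables (R : realType) (G : markov_topograph R).
Variable f : int -> int -> region G.

Definition mstar (k n : int) : R := label (f k n).

Definition lattice_point (k n : int) : explane R :=
  let h := rho `|mstar k n| in
  let l := Num.sqrt (n%:~R ^+ 2 + k%:~R ^+ 2) in
  if h == 0 then AtInfinity (n%:~R / l, k%:~R / l)
  else Affine (n%:~R / h, k%:~R / h).

Definition lattice_points : set (explane R) :=
  [set p | exists k n : int, coprimez k n /\ p = lattice_point k n].

(* [phi i k n] is phi_i(k/n). *)
Definition phi (i : 'I_4) (k n : nat) : R :=
  let x := match val i with
           | 0%N => mstar n%:Z k%:Z
           | 1%N => mstar k%:Z n%:Z
           | 2%N => mstar (- k%:Z) n%:Z
           | _ => mstar (- n%:Z) k%:Z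
           end in
  rho `|x| / n%:R.

Definition continuous_extension (phi : nat -> nat -> R) (Phi : R -> R) : Prop :=
  {within `[0, 1], continuous Phi} /\
  forall k n : nat, (0 < n)%N -> (k <= n)%N -> coprime k n ->
    Phi (k%:R / n%:R) = phi k n.

Definition lattice_curve (Phi : 'I_4 -> R -> R) : set (R * R) :=
  let direction (i : 'I_4) (x : R) : R * R :=
    match val i with
    | 0%N => (x, 1)
    | 1%N => (1, x)
    | 2%N => (- 1, x)
    | _ => (x, - 1)
    end in
  let half := [set p | exists (i : 'I_4) (x : R),
    [/\ 0 <= x <= 1, Phi i x != 0 &
        p = ((direction i x).1 / Phi i x, (direction i x).2 / Phi i x)]] in
  half `|` [set - p | p in half].

(* [theta] is on the line whose slope is the index of one of the regions 1/0,
   1/1, 0/1, and that region has label -2. *)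
Definition special_angle (theta : R) : Prop :=
  exists k n : int,
    [/\ (k, n) \in [:: (1, 0); (1, 1); (0, 1)], mstar k n = -2 &
        has_slope theta k n].

Definition extends_lattice_points (rad : R -> \bar R) : Prop :=
  polar_radius rad /\ lattice_points `<=` polar_curve rad.

End Lattice.

(* Main.v *)
Require Import Defs.
From mathcomp Require Import all_boot all_order all_algebra.
From mathcomp Require Import all_classical all_reals all_analysis.
From mathcomp Require Import ring lra zify.

Set Implicit Arguments.
Unset Strict Implicit.
Unset Printing Implicit Defensive.

Import Order.TTheory GRing.Theory Num.Theory.
Import numFieldNormedType.Exports.

Local Open Scope classical_set_scope.
Local Open Scope ring_scope.

(* Put F(n, k) = rho |m*_{k/n}| on primitive vectors, so that the curve is F = 1
   for a continuous homogeneous extension of F to the plane.  In each of the six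
   sectors, with basis the two central regions bounding it, the absolute values
   of the labels satisfy the Markov rule M(2x + y) = M(x) M(x + y) - M(y) on
   Farey pairs, and W = M(x + y) is the larger root of X^2 + Y^2 + W^2 - XYW = D.
   Since D > 4, the labels along the boundary of a region w inside the sector are
   A e^{j F(w)} + B e^{- j F(w)} with AB < 1, so that F has a strictly concave
   corner at w.  The one-sided tangents of F at w bound F on the whole sector, by
   induction along the Farey tree, downwards and upwards.  Hence F is the
   restriction of the infimum of the linear forms that dominate it, which is
   concave, homogeneous and nondecreasing, and therefore continuous up to the
   boundary of the sector. *)

(** * Triples of labels *)

(** The value D = 4 is the degenerate case: there the relation between X, Y, W is the addition
    formula of cosh, the larger root satisfies rho W = rho X + rho Y, and F would be linear in each
    sector. A negative well gives D >= 20. The obstacle is a central label -2. It has height 0 while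
    the labels along its boundary still grow, so F has an infinite one-sided slope there and no
    dominating form is tight at that generator. Hence tangents are compared after multiplication by
    [spread], which vanishes at the label 2; the value of the infimum at a generator is approached
    by forms tight at nearby mediants; and continuity at the boundary uses homogeneity and
    monotonicity, not concavity alone. Inside a sector all labels exceed 2 in absolute value and
    each primitive vector carries two different tight forms, which makes the superadditivity
    strict. *)

Section GrowingTriples.
Variable R : realType.
Implicit Types X Y W D l : R.

Lemma rho_ge0 X : 2 <= X -> 0 <= rho X.
Proof. by move=> hX; apply: arccosh_ge0; lra. Qed.

Lemma expR_rho X : 2 <= X -> expR (rho X) + expR (- rho X) = X.
Proof. by move=> hX; have := @arccoshK R (X / 2) ltac:(lra); rewrite /cosh /rho; lra. Qed.

Lemma expR_rho_pair X : 2 <= X -> exists a b : R,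
  [/\ expR (rho X) = a, expR (- rho X) = b, 1 <= a, 0 < b & b <= 1] /\
  [/\ a * b = 1 & X = a + b].
Proof.
move=> hX; exists (expR (rho X)), (expR (- rho X)).
have h := rho_ge0 hX.
split; split=> //; rewrite ?expR_gt0 //.
- by rewrite -expR0 ler_expR.
- by rewrite -expR0 ler_expR; lra.
- by rewrite -expRD subrr expR0.
- by rewrite expR_rho.
Qed.

Lemma rho2 : rho 2 = 0 :> R.
Proof.
by rewrite /rho divff ?pnatr_eq0 // /arccosh expr1n subrr sqrtr0 addr0 ln1.
Qed.

Lemma rho_eq0 X : 2 <= X -> rho X = 0 -> X = 2.
Proof.
by move=> hX h; have := expR_rho hX; rewrite h oppr0 expR0; lra.
Qed.

Definition growing D X Y W : Prop :=
  [/\ 2 <= X, 2 <= Y, X * Y < 2 * W & X ^+ 2 + Y ^+ 2 + W ^+ 2 - X * Y * W = D].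

(* Along the boundary of a region of label [X], with neighbouring labels
   [Y, W, X * W - Y, ...] (terms [A * e^(j * rho X) + B * e^(- j * rho X)]), these
   are [e^rho X - e^(- rho X)] and [A] times it. *)
Definition spread X : R := expR (rho X) - expR (- rho X).
Definition leading X Y W : R := W - Y * expR (- rho X).

Lemma growingC D X Y W : growing D X Y W -> growing D Y X W.
Proof. by case=> h1 h2 h3 h4; split=> //; [rewrite mulrC|rewrite -h4; ring]. Qed.

Lemma growing_ltr D X Y W : growing D X Y W -> Y < W.
Proof. case=> h1 h2 h3 _.
have : 2 * Y <= X * Y by rewrite ler_wpM2r //; lra.
by lra. Qed.

Lemma growing_ltl D X Y W : growing D X Y W -> X < W.
Proof. by move/growingC/growing_ltr. Qed.

Lemma growing_step D X Y W : growing D X Y W -> growing D X W (X * W - Y).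
Proof.
move=> g; have hY := growing_ltr g; have hX := growing_ltl g.
case: g => h1 h2 h3 h4.
have XW : 2 * W <= X * W by rewrite ler_wpM2r //; lra.
by split; [lra|lra|lra|rewrite -h4; ring].
Qed.

Lemma spread_ge0 X : 2 <= X -> 0 <= spread X.
Proof.
move=> /expR_rho_pair [a [b [[e1 e2 h1 h2 h3] [h4 h5]]]].
by rewrite /spread e1 e2; lra.
Qed.

Lemma spread_gt0 X : 2 < X -> 0 < spread X.
Proof.
move=> hX; have /expR_rho_pair [a [b [[e1 e2 h1 h2 h3] [h4 h5]]]] := ltW hX.
by rewrite /spread e1 e2; nra.
Qed.

(** With s = [spread X], A = [leading X Y W], c = e^(rho Y) and d = e^(- rho Y), the relation
    between X, Y, W reads (A - s c)(A - s d) = D - 4. Since W is the larger root, A is above the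
    mean of s c and s d, hence above s d, and the positive right side then forces A > s c. *)
Lemma leading_gt D X Y W : 4 < D -> growing D X Y W ->
  expR (rho Y) * spread X < leading X Y W.
Proof.
move=> hD g; have hY := growing_ltr g.
case: g => h1 h2 h3 h4.
have [a [b [[e1 e2 a1 b0 b1] [ab Xab]]]] := expR_rho_pair h1.
have [c [d [[e3 e4 c1 d0 d1] [cd Ycd]]]] := expR_rho_pair h2.
rewrite /spread /leading e1 e2 e3.
set s := a - b; set A := W - Y * b.
have key : (A - s * c) * (A - s * d) = D - 4.
  rewrite -h4 /A /s Xab Ycd.
  transitivity ((W - (c + d) * b) ^+ 2
     - (a - b) * (c + d) * (W - (c + d) * b) + (a - b) ^+ 2 * (c * d)).
    by ring.
  rewrite cd; transitivity (W ^+ 2 - (a + b) * (c + d) * W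
    + (c + d) ^+ 2 * (a * b) + (a + b) ^+ 2 - 4 * (a * b)); first by ring.
  by rewrite ab; ring.
clear h4.
have s0 : 0 <= s by rewrite /s; lra.
have A0 : s * Y < 2 * A by rewrite /s /A; move: h3; rewrite Xab; lra.
have sd : 0 < A - s * d.
  have : s * d <= s * c by rewrite ler_wpM2l //; lra.
  by move: A0; rewrite Ycd; lra.
have : 0 < (A - s * c) * (A - s * d) by rewrite key subr_gt0.
by rewrite pmulr_lgt0 //; lra.
Qed.

Lemma leading_gt0 D X Y W : growing D X Y W -> 0 < leading X Y W.
Proof.
move=> g; have hY := growing_ltr g; case: g => h1 h2 h3 h4.
have [a [b [[e1 e2 a1 b0 b1] [ab Xab]]]] := expR_rho_pair h1.
have : Y * b <= Y * 1 by rewrite ler_wpM2l //; lra.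
by rewrite /leading e2; lra.
Qed.

Lemma rho_lt_leading D X Y W l : 4 < D -> growing D X Y W ->
  leading X Y W <= expR l * spread X -> rho Y < l.
Proof.
move=> hD g h; have := lt_le_trans (leading_gt hD g) h.
have := spread_ge0 (let: And4 h _ _ _ := g in h).
rewrite le_eqVlt => /predU1P[<-|s0]; first by rewrite !mulr0 ltxx.
by rewrite ltr_pM2r // ltr_expR.
Qed.

Lemma leading_step X Y W : 2 <= X ->
  leading X W (X * W - Y) = expR (rho X) * leading X Y W.
Proof.
move=> hX; have [a [b [[e1 e2 a1 b0 b1] [ab Xab]]]] := expR_rho_pair hX.
rewrite /leading e1 e2 Xab; transitivity (a * W - (a * b) * Y); last by ring.
by rewrite ab; ring.
Qed.

(* If [A] and [B] are the coefficients seen from the two sides of the region of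
   label [W], then [A * B = e^rho W * (W^2 - D) / (W^2 - 4)]; this is what makes
   the encoding function concave at [W]. *)
Lemma leading_mul D X Y W : 4 < D -> growing D X Y W ->
  leading W X (W * X - Y) * leading W Y (W * Y - X) <
  expR (rho W) * spread W ^+ 2.
Proof.
move=> hD g; have hY := growing_ltr g; case: g => h1 h2 h3 h4.
have h5 : 2 <= W by lra.
have [u [v [[e5 e6 u1 v0 v1] [uv Wuv]]]] := expR_rho_pair h5.
rewrite /leading /spread e5 e6.
have -> : (W * X - Y - X * v) * (W * Y - X - Y * v) = u * (W ^+ 2 - D).
  rewrite -h4 Wuv.
  transitivity (u ^+ 2 * X * Y + X * Y - u * (X ^+ 2 + Y ^+ 2)); first by ring.
  transitivity (u ^+ 2 * X * Y + (u * v) * X * Y - u * (X ^+ 2 + Y ^+ 2)).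
    by rewrite uv; ring.
  by ring.
rewrite ltr_pM2l; last by lra.
have -> : (u - v) ^+ 2 = W ^+ 2 - 4 * (u * v) by rewrite Wuv; ring.
by rewrite uv; lra.
Qed.

End GrowingTriples.

(** * Farey pairs *)

(** The edges of the Farey tree under the root pair. With the swap, one growth step yields both
    children, and every estimate at [x] can be reused at [y]. *)
Inductive farey_pair : nat * nat -> nat * nat -> Prop :=
  | farey_root : farey_pair (1, 0)%N (0, 1)%N
  | farey_swap x y : farey_pair x y -> farey_pair y x
  | farey_step x y : farey_pair x y -> farey_pair x (x + y).

Lemma farey_pair_root (v : nat * nat) :
  v = ((1, 0)%N : nat * nat) *+ v.1 + ((0, 1)%N : nat * nat) *+ v.2.
Proof.
case: v => a b /=; have mul (u : nat * nat) n : u *+ n = (u.1 * n, u.2 * n)%N.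
  by case: u => p q; elim: n => [|n IH] /=;
    rewrite ?muln0 // mulrS IH !mulnS.
by rewrite !mul /= !mul1n !mul0n -[RHS]/(a + 0, 0 + b)%N addn0.
Qed.

Lemma farey_pair_det x y : farey_pair x y ->
  (x.1 * y.2 = y.1 * x.2 + 1 \/ y.1 * x.2 = x.1 * y.2 + 1)%N.
Proof.
elim=> [|{}x {}y _ [] h|{}x {}y _ [] h].
- by left.
- by right; rewrite h.
- by left; rewrite h.
- by left; rewrite /=; rewrite -/(x.1 + y.1)%N; move: h; clear; nia.
- by right; move: h; clear; rewrite /=; nia.
Qed.

Lemma coprime_subl i j : (j <= i)%N -> coprime (i - j) j = coprime i j.
Proof. by move=> le; rewrite /coprime gcdnC -gcdnDr subnK // gcdnC. Qed.

(** Subtractive Euclid on the coefficients: for j < i, i x + j y = (i - j) x + j (x + y), and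
    coprimality makes the process end at coefficients 1, 1. *)
Lemma farey_pair_mediant (i j : nat) x y : (0 < i)%N -> (0 < j)%N ->
  coprime i j -> farey_pair x y ->
  exists x' y', farey_pair x' y' /\ x *+ i + y *+ j = x' + y'.
Proof.
have [n] := ubnP (i + j); elim: n i j x y => // n IH i j x y.
wlog le_ji : i j x y / (j <= i)%N.
  move=> wl hn i0 j0 co xy; case: (leqP j i) => [le|/ltnW le]; first exact: wl.
  rewrite addrC; apply: wl => //; first by rewrite addnC.
    by rewrite coprime_sym.
  exact: farey_swap.
move=> hn i0 j0 co xy; move: le_ji; rewrite leq_eqVlt => /predU1P[E|lt_ji].
  move: co; rewrite E /coprime gcdnn => /eqP ->.
  by exists x, y; rewrite !mulr1n.
have := @IH (i - j)%N j x (x + y); case=> //.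
- by lia.
- by lia.
- by rewrite coprime_subl // ltnW.
- exact: farey_step.
move=> x' [y' [xy' E]]; exists x', y'; split=> //; rewrite -E.
by rewrite mulrnDl addrA -mulrnDr subnK // ltnW.
Qed.

(** * Linear forms dominating the heights of a sector *)

(* [(i, j)] stands for the region [i p + j q] of a sector spanned by [p, q]. *)
Definition sector_labels (R : realType) (D : R) (M : nat * nat -> R) : Prop :=
  4 < D /\ forall x y, farey_pair x y ->
    growing D (M x) (M y) (M (x + y)) /\
    M (x + (x + y)) = M x * M (x + y) - M y.

Section Domination.
Variables (R : realType) (D : R) (M : nat * nat -> R).
Hypothesis HM : sector_labels D M.
Implicit Types (x y : nat * nat) (l : R * R).

Let D4 : 4 < D := HM.1.
Let grow x y (xy : farey_pair x y) := (HM.2 x y xy).1.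
Let rec x y (xy : farey_pair x y) := (HM.2 x y xy).2.

Definition height x : R := rho (M x).
Definition lin l x : R := l.1 * x.1%:R + l.2 * x.2%:R.
(** ln ([lead x y] / [spread (M x)]) is the value at [y] of the tangent of [height] at [x] from the
    cone of [x] and [y]. Bounds on it are written without the quotient, since [M x] may be 2 at a
    generator of the sector. *)
Definition lead x y : R := leading (M x) (M y) (M (x + y)).
Definition dominates l x y : Prop := forall i j, coprime i j ->
  height (x *+ i + y *+ j) <= lin l (x *+ i + y *+ j).

Lemma linD l x y : lin l (x + y) = lin l x + lin l y.
Proof. by rewrite /lin /= !natrD; ring. Qed.

Lemma linMn l x n : lin l (x *+ n) = lin l x *+ n.
Proof.
elim: n => [|n IH]; first by rewrite /lin /= !mulr0 addr0.
by rewrite !mulrS linD IH.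
Qed.

Lemma lead_step x y : farey_pair x y ->
  lead x (x + y) = expR (height x) * lead x y.
Proof.
move=> xy; rewrite /lead rec // leading_step //.
by case: (grow xy).
Qed.

Lemma lead_mediant x y : farey_pair x y ->
  lead (x + y) x = leading (M (x + y)) (M x) (M (x + y) * M x - M y).
Proof. by move=> xy; rewrite /lead [x + y + x]addrC rec // mulrC. Qed.

Lemma lead_mul x y : farey_pair x y ->
  lead (x + y) x * lead (x + y) y <
  expR (height (x + y)) * spread (M (x + y)) ^+ 2.
Proof.
move=> xy; have yx := farey_swap xy.
rewrite lead_mediant // [in lead _ y]addrC lead_mediant // [y + x]addrC.
exact: leading_mul (grow xy).
Qed.

Lemma spreadM_ge0 x y : farey_pair x y -> 0 <= spread (M x).
Proof. by case/grow => h _ _ _; exact: spread_ge0. Qed.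

Lemma height_lt_lead x y a : farey_pair x y ->
  lead x y <= expR a * spread (M x) -> height y < a.
Proof. by move=> xy; apply: rho_lt_leading (grow xy). Qed.

(** Moving from [y] to [x + y] multiplies [lead] by e^(height x), so the tangent bound at [y]
    carries over with [height x] added. *)
Lemma mediant_lt_lead x y a : farey_pair x y ->
  lead x y <= expR a * spread (M x) -> height (x + y) < height x + a.
Proof.
move=> xy h; apply: height_lt_lead (farey_step xy) _.
by rewrite lead_step // expRD -mulrA ler_wpM2l // expR_ge0.
Qed.

(** By [lead_mul], the tangents at [x + y] from its two sides take at [x] and at [y] values whose
    sum is less than the height of [x + y]; a lower bound on one of them is thus an upper bound on
    the other. *)
Lemma lead_cross x y a b : farey_pair x y ->
  expR b * spread (M (x + y)) <= lead (x + y) y -> height (x + y) <= a + b ->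
  lead (x + y) x < expR a * spread (M (x + y)).
Proof.
move=> xy hb hab; rewrite ltNge; apply/negP => ha.
have s0 : 0 <= spread (M (x + y)).
  by apply: (@spreadM_ge0 _ x); apply: farey_swap; apply: farey_step.
have := lead_mul xy; rewrite ltNge => /negP; apply.
have : (expR a * spread (M (x + y))) * (expR b * spread (M (x + y))) <=
    lead (x + y) x * lead (x + y) y.
  by apply: ler_pM => //; rewrite mulr_ge0 // expR_ge0.
apply: le_trans; rewrite mulrACA -expRD -expr2 ler_wpM2r ?sqr_ge0 //.
by rewrite ler_expR.
Qed.

(** As for a concave function, tangent values at [y] decrease when the point of contact moves from
    [x] towards [y]. At [x + y] the tangent from the side of [x] exceeds [height x], by
    [leading_gt], and [lead_cross] turns this into the bound on the side of [y]. *)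
Lemma lead_mono x y b : farey_pair x y ->
  lead x y <= expR b * spread (M x) ->
  lead (x + y) y < expR b * spread (M (x + y)).
Proof.
move=> xy hb; have yx := farey_swap xy.
have h : expR (height x) * spread (M (y + x)) <= lead (y + x) x.
  by apply: ltW; apply: leading_gt D4 (grow _); rewrite addrC; apply: farey_swap;
     apply: farey_step.
rewrite [x + y]addrC; apply: (lead_cross yx h).
by rewrite [y + x]addrC [b + _]addrC ltW // mediant_lt_lead.
Qed.

(** Descent of the Farey tree. Lying above [height] at [x] and above its tangent there passes to
    both children of the pair: the point of contact stays [x] in the cone of [x], [x + y] and
    becomes [x + y] in the cone of [x + y], [y]. *)
Lemma height_dominated l x y : farey_pair x y -> height x <= lin l x ->
  lead x y <= expR (lin l y) * spread (M x) -> dominates l x y.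
Proof.
move=> xy hx hy i j; have [n] := ubnP (i + j).
elim: n i j x y xy hx hy => // n IH i j x y xy hx hy hn co.
have hz := mediant_lt_lead xy hy.
case: i j co hn => [|i] [|j] // co hn.
- move: co; rewrite /coprime gcd0n => /eqP ->; rewrite mulr0n add0r mulr1n.
  exact: ltW (height_lt_lead xy hy).
- move: co; rewrite /coprime gcdn0 => /eqP ->; rewrite mulr0n addr0 mulr1n.
  exact: hx.
case: (leqP j i) => [le_ji|lt_ij].
- have -> : x *+ i.+1 + y *+ j.+1 = x *+ (i - j) + (x + y) *+ j.+1.
    by rewrite mulrnDl addrA -mulrnDr addnS subnK.
  apply: IH => //.
  + exact: farey_step.
  + rewrite lead_step // linD expRD -mulrA.
    apply: ler_pM; rewrite ?expR_ge0 ?ler_expR //.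
    by apply: ltW; apply: leading_gt0 (grow xy).
  + by lia.
  + by rewrite -subSS coprime_subl.
- have -> : x *+ i.+1 + y *+ j.+1 = (x + y) *+ i.+1 + y *+ (j - i).
    by rewrite mulrnDl -addrA -mulrnDr addSn subnKC // ltnW.
  apply: IH => //.
  + by apply: farey_swap; rewrite addrC; apply: farey_step; apply: farey_swap.
  + by rewrite linD ltW // (lt_le_trans hz) // lerD2r.
  + by apply: ltW; apply: lead_mono.
  + by lia.
  + by rewrite -subSS coprime_sym coprime_subl 1?coprime_sym // ltnW.
Qed.

Lemma dominates_swap l x y : dominates l x y -> dominates l y x.
Proof. by move=> h i j co; rewrite addrC; apply: h; rewrite coprime_sym. Qed.

Lemma dominates_glue l x y :
  dominates l x (x + y) -> dominates l (x + y) y -> dominates l x y.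
Proof.
move=> h1 h2 i j co; case: (leqP j i) => [le_ji|/ltnW le_ij].
- have -> : x *+ i + y *+ j = x *+ (i - j) + (x + y) *+ j.
    by rewrite mulrnDl addrA -mulrnDr subnK.
  by apply: h1; rewrite coprime_subl.
- have -> : x *+ i + y *+ j = (x + y) *+ i + y *+ (j - i).
    by rewrite mulrnDl -addrA -mulrnDr subnKC.
  by apply: h2; rewrite coprime_sym coprime_subl 1?coprime_sym.
Qed.

(* The linear form [l] lies between [height] and its tangent from the cone of
   [x, y] at each of [x] and [y]. *)
Definition tangent l x y : Prop :=
  [/\ height x <= lin l x, height y <= lin l y,
      expR (lin l y) * spread (M x) <= lead x y &
      expR (lin l x) * spread (M y) <= lead y x].

(** Ascent to the root. From [x], [x + y] to [x], [y] the cone gained is that of [x + y], [y]. There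
    [l] is above the tangent at [x + y], because it is below the tangent on the side of [x], and so
    [height_dominated] applies. *)
Lemma tangent_dominates l x y : farey_pair x y ->
  tangent l x y -> dominates l x y -> dominates l (1, 0)%N (0, 1)%N.
Proof.
elim=> [||{}x {}y xy IH]; first by [].
  move=> {}x {}y _ IH [a b c d] h; apply: IH; last exact: dominates_swap.
  by split; [exact: b|exact: a|exact: d|exact: c].
case=> hx hz hzx hxz dom.
have yx := farey_swap xy.
have hy : lead (x + y) y < expR (lin l y) * spread (M (x + y)).
  rewrite [x + y]addrC; apply: (lead_cross (b := lin l x) yx).
    by rewrite [y + x]addrC.
  by rewrite [y + x]addrC -linD [y + x]addrC.
have zy : farey_pair (x + y) y by rewrite addrC; apply/farey_swap/farey_step.
apply: IH; last first.
  by apply: dominates_glue => //; apply: height_dominated => //; apply: ltW.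
split; [exact: hx| | |].
- exact: ltW (height_lt_lead zy (ltW hy)).
- have e0 := expR_gt0 (height x).
  rewrite -(ler_pM2l e0) -(lead_step xy); apply: le_trans hzx; rewrite mulrA -expRD.
  by rewrite ler_wpM2r ?(spreadM_ge0 xy) // ler_expR linD lerD2r.
- rewrite leNgt; apply/negP => /ltW /(lead_mono yx).
  by rewrite ltNge [y + x]addrC hxz.
Qed.

Lemma mediant_gt2 x y : farey_pair x y -> 2 < M (x + y).
Proof.
move=> xy; have := growing_ltr (grow xy); case: (grow xy) => _ h _ _.
by apply: le_lt_trans.
Qed.

(** The form is the tangent at [x + y] from the side of [y], extended to the whole quadrant. On the
    side of [x] it lies above the other tangent, by [lead_cross], which settles the cone of the pair
    itself; [tangent_dominates] does the rest. *)
Lemma exists_tangent x y : farey_pair x y -> exists l,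
  [/\ dominates l (1, 0)%N (0, 1)%N, lin l (x + y) = height (x + y) &
      lead (x + y) y = expR (lin l y) * spread (M (x + y))].
Proof.
move=> xy; have yx := farey_swap xy.
have zx : farey_pair (x + y) x by apply/farey_swap/farey_step.
have zy : farey_pair (x + y) y by rewrite addrC; apply/farey_swap/farey_step.
have s0 : 0 < spread (M (x + y)) by apply: spread_gt0; apply: mediant_gt2.
have a0 : 0 < lead (x + y) y by apply: leading_gt0 (grow zy).
pose ly := ln (lead (x + y) y / spread (M (x + y))).
have Ely : expR ly * spread (M (x + y)) = lead (x + y) y.
  by rewrite lnK ?posrE ?divr_gt0 // divfK // gt_eqF.
pose lx := height (x + y) - ly.
have [l [Elx Ely']] : exists l, lin l x = lx /\ lin l y = ly.
  have : (x.1%:R * y.2%:R = y.1%:R * x.2%:R + 1 :> R) \/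
         (y.1%:R * x.2%:R = x.1%:R * y.2%:R + 1 :> R).
    by case: (farey_pair_det xy) => h; [left|right]; rewrite -!natrM h natrD.
  case=> h.
  - exists (lx * y.2%:R - ly * x.2%:R, ly * x.1%:R - lx * y.1%:R).
    rewrite /lin /=; split.
      by transitivity (lx * (x.1%:R * y.2%:R - y.1%:R * x.2%:R)); [ring|rewrite h; ring].
    by transitivity (ly * (x.1%:R * y.2%:R - y.1%:R * x.2%:R)); [ring|rewrite h; ring].
  - exists (ly * x.2%:R - lx * y.2%:R, lx * y.1%:R - ly * x.1%:R).
    rewrite /lin /=; split.
      by transitivity (lx * (y.1%:R * x.2%:R - x.1%:R * y.2%:R)); [ring|rewrite h; ring].
    by transitivity (ly * (y.1%:R * x.2%:R - x.1%:R * y.2%:R)); [ring|rewrite h; ring].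
have Elz : lin l (x + y) = height (x + y) by rewrite linD Elx Ely' /lx subrK.
exists l; rewrite Ely'; split=> //.
have hx : lead (x + y) x < expR lx * spread (M (x + y)).
  by apply: (lead_cross (b := ly) xy); rewrite ?Ely // /lx subrK.
have hxl := height_lt_lead zx (ltW hx).
have hyl : height y < ly by apply: (height_lt_lead zy); rewrite Ely.
apply: (tangent_dominates xy).
- split; rewrite ?Elx ?Ely'; [exact: ltW|exact: ltW| |].
  + rewrite leNgt; apply/negP => /ltW /(lead_mono xy).
    by rewrite Ely ltxx.
  + rewrite leNgt; apply/negP => /ltW /(mediant_lt_lead yx).
    by rewrite [y + x]addrC /lx; lra.
apply: dominates_glue.
- apply: dominates_swap; apply: height_dominated => //; first by rewrite Elz.
  by rewrite Elx ltW.
- by apply: height_dominated => //; [rewrite Elz|rewrite Ely' Ely].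
Qed.

End Domination.

(** * The concave envelope *)

Lemma coprimez_reduce (m n : int) : (m != 0) || (n != 0) ->
  exists g m' n' : int, [/\ 0 < g, coprimez m' n', m = g * m' & n = g * n'].
Proof.
move=> mn0; have g0 : 0 < gcdz m n.
  by rewrite lt_neqAle eq_sym gcdz_eq0 negb_and mn0.
exists (gcdz m n), (m %/ gcdz m n)%Z, (n %/ gcdz m n)%Z.
have Em : m = gcdz m n * (m %/ gcdz m n)%Z by rewrite mulrC divzK // dvdz_gcdl.
have En : n = gcdz m n * (n %/ gcdz m n)%Z by rewrite mulrC divzK // dvdz_gcdr.
split=> //; apply/eqP; apply: (mulfI (lt0r_neq0 g0)).
by rewrite mulr1 -[X in X * _](gtr0_norm g0) -abszE mulz_gcdr -Em -En.
Qed.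

(** The vector N ((a, b) + (c, d)) has determinant N e with each side of the cone, which for large N
    exceeds the error made by flooring its coordinates; dividing by the gcd keeps it in the cone. *)
Lemma coprimez_in_cone (R : realType) (a b c d : R) : 0 < a * d - b * c ->
  exists n k : int, [/\ coprimez k n, 0 < a * k%:~R - b * n%:~R &
    0 < n%:~R * d - k%:~R * c].
Proof.
set e := a * d - b * c => e0.
pose S := `|a| + `|b| + `|c| + `|d|.
pose N : R := (Num.bound (S / e))%:R.
have S0 : 0 <= S by rewrite !addr_ge0.
have hN : S < N * e.
  by rewrite -ltr_pdivrMr //; apply: archi_boundP; rewrite divr_ge0 // ltW.
pose n := Num.floor (N * (a + c)); pose k := Num.floor (N * (b + d)).
have /andP[n1 n2] : n%:~R <= N * (a + c) < (n + 1)%:~R.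
  by rewrite real_floor_itv // num_real.
have /andP[k1 k2] : k%:~R <= N * (b + d) < (k + 1)%:~R.
  by rewrite real_floor_itv // num_real.
rewrite !intrD in n2 k2.
pose fn := N * (a + c) - n%:~R; pose fk := N * (b + d) - k%:~R.
have bnd x y : 0 <= y -> y <= 1 -> `|x * y| <= `|x| :> R.
  by move=> y0 y1; rewrite normrM (ger0_norm y0) ler_piMr.
have fn0 : 0 <= fn by rewrite subr_ge0.
have fk0 : 0 <= fk by rewrite subr_ge0.
have fn1 : fn <= 1 by rewrite /fn; lra.
have fk1 : fk <= 1 by rewrite /fk; lra.
have h1 : 0 < a * k%:~R - b * n%:~R.
  have -> : a * k%:~R - b * n%:~R = N * e - a * fk + b * fn.
    by rewrite /e /fn /fk; ring.
  have := bnd a fk fk0 fk1; have := bnd b fn fn0 fn1.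
  rewrite !ler_norml => /andP[? ?] /andP[? ?].
  by have := normr_ge0 c; have := normr_ge0 d; move: hN; rewrite /S; lra.
have h2 : 0 < n%:~R * d - k%:~R * c.
  have -> : n%:~R * d - k%:~R * c = N * e - d * fn + c * fk.
    by rewrite /e /fn /fk; ring.
  have := bnd d fn fn0 fn1; have := bnd c fk fk0 fk1.
  rewrite !ler_norml => /andP[? ?] /andP[? ?].
  by have := normr_ge0 a; have := normr_ge0 b; move: hN; rewrite /S; lra.
have : (k != 0) || (n != 0).
  rewrite -negb_and; apply/negP => /andP[/eqP k0 /eqP n0].
  by move: h1; rewrite k0 n0 !mulr0 subrr ltxx.
case/coprimez_reduce => g [k' [n' [g0 co Ek En]]].
have gR : 0 < g%:~R :> R by rewrite ltr0z.
exists n', k'; split=> //.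
- rewrite -(pmulr_rgt0 _ gR); move: h1; rewrite Ek En !intrM.
  by congr (0 < _); ring.
- rewrite -(pmulr_rgt0 _ gR); move: h2; rewrite Ek En !intrM.
  by congr (0 < _); ring.
Qed.

Section Envelope.
Variables (R : realType) (D : R) (M : nat * nat -> R).
Hypothesis HM : sector_labels D M.
Implicit Types (x y : nat * nat) (l : R * R) (a b c d : R).

Let dom l := dominates M l (1, 0)%N (0, 1)%N.
Let D4 : 4 < D := HM.1.
Let grow x y (xy : farey_pair x y) := (HM.2 x y xy).1.

Definition ev l a b : R := l.1 * a + l.2 * b.

Lemma dom_coprime l i j : dom l -> coprime i j -> height M (i, j) <= ev l i%:R j%:R.
Proof.
by move=> dl co; have := dl i j co; rewrite -(farey_pair_root (i, j)).
Qed.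

Lemma height_ge0 x y : farey_pair x y -> 0 <= height M x.
Proof. by case/grow => h _ _ _; exact: rho_ge0. Qed.

Lemma dom1 l : dom l -> height M (1, 0)%N <= l.1.
Proof. by move=> /dom_coprime /(_ (isT : coprime 1 0)); rewrite /ev mulr1 mulr0 addr0. Qed.

Lemma dom2 l : dom l -> height M (0, 1)%N <= l.2.
Proof. by move=> /dom_coprime /(_ (isT : coprime 0 1)); rewrite /ev mulr1 mulr0 add0r. Qed.

Lemma dom_ge0 l : dom l -> 0 <= l.1 /\ 0 <= l.2.
Proof.
move=> dl; have r := farey_root; split.
- exact: le_trans (height_ge0 r) (dom1 dl).
- exact: le_trans (height_ge0 (farey_swap r)) (dom2 dl).
Qed.

Lemma ev_ge0 l a b : dom l -> 0 <= a -> 0 <= b -> 0 <= ev l a b.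
Proof. by move=> /dom_ge0[? ?] ? ?; rewrite addr_ge0 // mulr_ge0. Qed.

Definition envelope a b : R := inf [set ev l a b | l in [set l | dom l]].

Lemma dom_nonempty : exists l, dom l.
Proof. by have [l [dl _ _]] := exists_tangent HM farey_root; exists l. Qed.

Lemma envelope_has_inf a b : 0 <= a -> 0 <= b ->
  has_inf [set ev l a b | l in [set l | dom l]].
Proof.
move=> a0 b0; split; first by have [l dl] := dom_nonempty; exists (ev l a b), l.
by exists 0 => _ [l dl <-]; exact: ev_ge0.
Qed.

Lemma envelope_le l a b : 0 <= a -> 0 <= b -> dom l -> envelope a b <= ev l a b.
Proof.
move=> a0 b0 dl; apply: ge_inf; last by exists l.
by case: (envelope_has_inf a0 b0).
Qed.

Lemma envelope_ge c a b : (forall l, dom l -> c <= ev l a b) -> c <= envelope a b.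
Proof.
move=> h; apply: lb_le_inf; first by have [l dl] := dom_nonempty; exists (ev l a b), l.
by move=> _ [l dl <-]; exact: h.
Qed.

Lemma envelope_adherent e a b : 0 <= a -> 0 <= b -> 0 < e ->
  exists2 l, dom l & ev l a b < envelope a b + e.
Proof.
move=> a0 b0 e0; have [_ [l dl <-] h] := inf_adherent e0 (envelope_has_inf a0 b0).
by exists l.
Qed.

Lemma envelope_ge0 a b : 0 <= a -> 0 <= b -> 0 <= envelope a b.
Proof. by move=> a0 b0; apply: envelope_ge => l dl; exact: ev_ge0. Qed.

Lemma envelopeZ c a b : 0 <= a -> 0 <= b -> 0 < c ->
  envelope (c * a) (c * b) = c * envelope a b.
Proof.
move=> a0 b0 c0; have evZ l : ev l (c * a) (c * b) = c * ev l a b.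
  by rewrite /ev; ring.
apply/eqP; rewrite eq_le; apply/andP; split.
- rewrite -ler_pdivrMl //; apply: envelope_ge => l dl.
  by rewrite ler_pdivrMl // -evZ envelope_le // mulr_ge0 // ltW.
- by apply: envelope_ge => l dl; rewrite evZ ler_pM2l // envelope_le.
Qed.

Lemma envelope00 : envelope 0 0 = 0.
Proof.
apply/eqP; rewrite eq_le envelope_ge0 // andbT.
have [l dl] := dom_nonempty.
by have := envelope_le (lexx 0) (lexx 0) dl; rewrite /ev !mulr0 addr0.
Qed.

Lemma envelopeD a b c d : 0 <= a -> 0 <= b -> 0 <= c -> 0 <= d ->
  envelope a b + envelope c d <= envelope (a + c) (b + d).
Proof.
move=> a0 b0 c0 d0; apply: envelope_ge => l dl.
have -> : ev l (a + c) (b + d) = ev l a b + ev l c d by rewrite /ev; ring.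
by rewrite lerD // envelope_le.
Qed.

Lemma envelope_mono a b c d : 0 <= a -> 0 <= b -> a <= c -> b <= d ->
  envelope a b <= envelope c d.
Proof.
move=> a0 b0 ac bd; apply: envelope_ge => l dl; have [l1 l2] := dom_ge0 dl.
by apply: le_trans (envelope_le a0 b0 dl) _; rewrite lerD // ler_wpM2l.
Qed.

Lemma farey_chain x y j : farey_pair x y -> farey_pair x (x *+ j + y).
Proof.
move=> xy; elim: j => [|j IH]; first by rewrite mulr0n add0r.
by rewrite mulrS -addrA; apply: farey_step.
Qed.

Lemma lead_chain x y j : farey_pair x y ->
  lead M x (x *+ j + y) = expR (height M x *+ j) * lead M x y.
Proof.
move=> xy; elim: j => [|j IH]; first by rewrite !mulr0n add0r expR0 mul1r.
rewrite !mulrS -addrA (lead_step HM (farey_chain j xy)) IH.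
by rewrite expRD mulrA.
Qed.

(** Writing M_j for the label of j x + y and h for [height M x], the recurrence reads M_(j+1) = e^(j
    h) [lead M x y] + e^(- h) M_j. Bounding e^(- h) by 1 keeps the case h = 0, where the labels grow
    linearly. *)
Lemma label_chain x y j : farey_pair x y ->
  M (x *+ j + y) <= expR (height M x *+ j) * (M y + j%:R * lead M x y).
Proof.
move=> xy; have h0 := height_ge0 xy.
have a0 : 0 < lead M x y by exact: leading_gt0 (grow xy).
have My : 0 <= M y by case: (grow xy); lra.
elim: j => [|j IH]; first by rewrite !mulr0n expR0 add0r mul0r addr0 mul1r.
have E := lead_chain j xy; rewrite /lead /leading in E.
rewrite mulrS -addrA.
have e1 : M (x *+ j + y) * expR (- rho (M x)) <= M (x *+ j + y).
  rewrite ler_piMr //; last by rewrite -expR0 ler_expR oppr_le0.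
  by case: (grow (farey_chain j xy)); lra.
have -> : M (x + (x *+ j + y)) =
    expR (height M x *+ j) * lead M x y + M (x *+ j + y) * expR (- rho (M x)).
  by rewrite -E subrK.
have : expR (height M x *+ j) * (M y + j.+1%:R * lead M x y) <=
       expR (height M x + height M x *+ j) * (M y + j.+1%:R * lead M x y).
  rewrite ler_wpM2r //; last by rewrite ler_expR lerDr.
  by rewrite addr_ge0 // mulr_ge0 // ltW.
rewrite [height M x *+ j.+1]mulrS; apply: le_trans; rewrite -natr1.
by move: IH e1; lra.
Qed.

Lemma ln_sublinear_affine a b e : 0 <= a -> 0 < b -> 0 < e ->
  exists2 j : nat, (0 < j)%N & ln (a + j%:R * b) <= e * j%:R.
Proof.
(* ln lies below its tangent at c, of slope e / (2 b): half of e j absorbs the linear term, the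
   other half the constant K. *)
move=> a0 b0 e0; pose c := 2 * b / e.
have c0 : 0 < c by rewrite divr_gt0 // mulr_gt0.
pose K := ln c + a / c - 1.
exists (Num.bound (2 * `|K| / e)).+1 => //; set j := _.+1.
have hj : 2 * K <= e * j%:R.
  have : 2 * `|K| / e < j%:R.
    apply: lt_trans (_ : (Num.bound (2 * `|K| / e))%:R < _).
      by apply: archi_boundP; rewrite divr_ge0 // ?mulr_ge0 // ltW.
    by rewrite ltr_nat.
  rewrite ltr_pdivrMr // [j%:R * e]mulrC => /ltW; apply: le_trans.
  by rewrite ler_pM2l // ler_norm.
have t0 : 0 < a + j%:R * b by rewrite ltr_wpDl // mulr_gt0.
have : ln ((a + j%:R * b) / c) <= (a + j%:R * b) / c - 1.
  have := @le_ln1Dx R ((a + j%:R * b) / c - 1); rewrite [1 + _]addrC subrK; apply.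
  by rewrite ltrBDr addNr divr_gt0.
rewrite ln_div ?posrE //.
have -> : (a + j%:R * b) / c = a / c + e * j%:R / 2.
  by rewrite mulrDl; congr (_ + _); rewrite /c; field; rewrite !gt_eqF.
by move: hj; rewrite /K; lra.
Qed.

(** A form tight at j x + y and nonnegative at y takes at x a value at most [height M x] plus the
    logarithm of an affine function of j divided by j, by [label_chain]. This stands in for a form
    tight at a generator, which may fail to exist. *)
Lemma dom_tight_generator x y e : farey_pair x y -> 0 < e ->
  (forall l, dom l -> 0 <= lin l y) ->
  exists2 l, dom l & lin l x <= height M x + e.
Proof.
move=> xy e0 hy.
have a0 : 0 < lead M x y by exact: leading_gt0 (grow xy).
have My : 0 <= M y by case: (grow xy); lra.
have [[//|j] _ hj] := ln_sublinear_affine My a0 e0.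
have xj := farey_chain j xy.
have [l [dl El _]] := exists_tangent HM xj; exists l => //.
move: El; rewrite addrA -mulrS linD linMn => El.
have M2 : 2 <= M (x *+ j.+1 + y) by case: (grow (farey_chain j.+1 xy)).
have E : height M (x *+ j.+1 + y) <= height M x *+ j.+1 + e * j.+1%:R.
  apply: le_trans (_ : ln (M (x *+ j.+1 + y)) <= _).
    rewrite -ler_expR lnK ?posrE; last by lra.
    rewrite -[leRHS](expR_rho M2) lerDl; exact: expR_ge0.
  have p0 : 0 < M y + j.+1%:R * lead M x y by rewrite ltr_wpDl // mulr_gt0.
  apply: le_trans (_ : ln (expR (height M x *+ j.+1) * (M y + j.+1%:R * lead M x y)) <= _).
    rewrite ler_ln ?posrE ?mulr_gt0 ?expR_gt0 //; last by lra.
    exact: label_chain.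
  by rewrite lnM ?posrE ?expR_gt0 // expRK lerD2l.
have := hy l dl; move: E; rewrite -El -(mulr_natr (lin l x)) -(mulr_natr (height M x)).
have j0 : 0 < j.+1%:R :> R by rewrite ltr0n.
by move=> h1 h2; rewrite -(ler_pM2r j0); lra.
Qed.

(** The tangents at a mediant from its two sides; if they were equal, the strict inequality of
    [lead_cross] would fail. *)
Lemma envelope_tight i j : (0 < i)%N -> (0 < j)%N -> coprime i j ->
  exists l l', [/\ dom l, dom l', ev l i%:R j%:R = height M (i, j),
    ev l' i%:R j%:R = height M (i, j) & l != l'].
Proof.
move=> i0 j0 co.
have [x [y [xy]]] := farey_pair_mediant i0 j0 co farey_root.
rewrite -(farey_pair_root (i, j)) => E.
have [l [dl El Hl]] := exists_tangent HM xy.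
have [l' [dl' El' Hl']] := exists_tangent HM (farey_swap xy).
exists l, l'; split=> //; first by rewrite E -El -E.
  by rewrite E [x + y]addrC -El' [y + x]addrC -E.
apply/eqP => ll'; move: Hl'; rewrite -ll' [y + x]addrC => /eqP; rewrite lt_eqF //.
apply: (lead_cross HM (b := lin l y) xy); first by rewrite Hl.
by rewrite -El linD.
Qed.

Lemma envelopeE i j : coprime i j -> envelope i%:R j%:R = height M (i, j).
Proof.
move=> co; apply/eqP; rewrite eq_le; apply/andP; split; last first.
  by apply: envelope_ge => l dl; exact: dom_coprime.
have r := farey_root.
case: i j co => [|i] [|j] // co.
- move: co; rewrite /coprime gcd0n => /eqP ->.
  apply/ler_addgt0Pr => e e0.
  have [|l dl hl] := dom_tight_generator (farey_swap r) e0.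
    by move=> l /dom_ge0[]; rewrite /lin /= mulr1 mulr0 addr0.
  apply: le_trans hl; apply: envelope_le => //.
- move: co; rewrite /coprime gcdn0 => /eqP ->.
  apply/ler_addgt0Pr => e e0.
  have [|l dl hl] := dom_tight_generator r e0.
    by move=> l /dom_ge0[]; rewrite /lin /= mulr1 mulr0 add0r.
  apply: le_trans hl; apply: envelope_le => //.
have [l [l' [dl _ <- _ _]]] := @envelope_tight i.+1 j.+1 isT isT co.
exact: envelope_le.
Qed.

(** In the case of equality, every form tight at a primitive vector inside the cone would agree with
    the envelope at the two spanning vectors, and be determined by these values; but there are two
    such forms. *)
Lemma envelopeD_lt a b c d : 0 <= a -> 0 <= b -> 0 <= c -> 0 <= d ->
  a * d - b * c != 0 ->
  envelope a b + envelope c d < envelope (a + c) (b + d).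
Proof.
wlog e0 : a b c d / 0 < a * d - b * c.
  move=> wl a0 b0 c0 d0 h; case: (ltrgt0P (a * d - b * c)) => e0.
  - exact: wl.
  - by rewrite addrC [a + c]addrC [b + d]addrC; apply: wl => //; lra.
  - by rewrite e0 eqxx in h.
move=> a0 b0 c0 d0 _.
have e1 : 0 < a * (b + d) - b * (a + c) by move: e0; lra.
(* Let u = (a, b) and v = (c, d). Choosing the primitive vector w between u and u + v gives e w = (p
   + q) u + q v, so that (p + q)(u + v) = e w + p v has nonnegative coefficients. *)
have [n [k [co q0 p0]]] := coprimez_in_cone e1.
have s1 : 0 < a + c.
  rewrite lt_neqAle addr_ge0 // andbT eq_sym; apply/eqP => s; move: e0.
  have [-> ->] : a = 0 /\ c = 0 by split; lra.
  by rewrite ?mul0r ?mulr0 subrr ltxx.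
have s2 : 0 < b + d.
  rewrite lt_neqAle addr_ge0 // andbT eq_sym; apply/eqP => s; move: e0.
  have [-> ->] : b = 0 /\ d = 0 by split; lra.
  by rewrite ?mul0r ?mulr0 subrr ltxx.
move: q0 p0; set q := a * k%:~R - _; set p := n%:~R * _ - _ => q0 p0.
set e := a * d - b * c in e0.
have En : e * n%:~R = p * a + q * (a + c) by rewrite /e /p /q; ring.
have Ek : e * k%:~R = p * b + q * (b + d) by rewrite /e /p /q; ring.
have n0 : 0 < n.
  by rewrite -(ltr0z R) -(pmulr_rgt0 _ e0) En ltr_wpDl ?mulr_gt0 // mulr_ge0 // ltW.
have k0 : 0 < k.
  by rewrite -(ltr0z R) -(pmulr_rgt0 _ e0) Ek ltr_wpDl ?mulr_gt0 // mulr_ge0 // ltW.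
case: n n0 co p q p0 q0 En Ek => [i|i] // i0 co p q p0 q0 En Ek.
case: k k0 co p q p0 q0 En Ek => [j|j] // j0 co p q p0 q0 En Ek.
rewrite !ltz_nat in i0 j0; rewrite -!pmulrn in p q p0 q0 En Ek.
rewrite coprimez_sym in co.
have [l [l' [dl dl' El El' ll']]] := envelope_tight i0 j0 co.
rewrite -/dom in dl dl'.
have W : envelope i%:R j%:R = height M (i, j) by exact: envelopeE.
have pq0 : 0 < p + q by rewrite addr_gt0.
have evw m : e * ev m i%:R j%:R = (p + q) * ev m a b + q * ev m c d.
  rewrite /ev mulrDr !mulrA ![e * _]mulrC -!mulrA En Ek; ring.
have strict : (p + q) * envelope a b + q * envelope c d < e * envelope i%:R j%:R.
  have uL := envelope_le a0 b0 dl; have vL := envelope_le c0 d0 dl.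
  have uL' := envelope_le a0 b0 dl'; have vL' := envelope_le c0 d0 dl'.
  have le1 : (p + q) * envelope a b + q * envelope c d <=
      (p + q) * ev l a b + q * ev l c d by rewrite lerD // ler_pM2l.
  rewrite W -El evw lt_neqAle le1 andbT; apply/eqP => Eq.
  have [Eu Ev] : ev l a b = ev l' a b /\ ev l c d = ev l' c d.
    have Eq' : (p + q) * envelope a b + q * envelope c d =
      (p + q) * ev l' a b + q * ev l' c d by rewrite Eq -!evw El El'.
    have pos_sum u v w z : 0 <= u -> 0 <= v -> 0 < w -> 0 < z ->
      w * u + z * v = 0 -> u = 0 /\ v = 0 :> R.
      move=> u0 v0 w0 z0 /eqP; rewrite paddr_eq0 ?mulr_ge0 ?(ltW w0) ?(ltW z0) //.
      by rewrite !mulf_eq0 (gt_eqF w0) (gt_eqF z0) /= => /andP[/eqP ? /eqP ?].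
    have [|||||] := pos_sum (ev l a b - envelope a b) (ev l c d - envelope c d) (p + q) q;
      rewrite ?subr_ge0 //; first by lra.
    have [|||||] := pos_sum (ev l' a b - envelope a b) (ev l' c d - envelope c d) (p + q) q;
      rewrite ?subr_ge0 //; first by lra.
    by move=> *; split; lra.
  case: l l' {dl dl' El El' uL vL uL' vL' le1 Eq} ll' Eu Ev => [l1 l2] [m1 m2] /= ll'.
  rewrite /ev /= => Eu Ev; case/negP: ll'; apply/eqP.
  have F1 : (l1 - m1) * e = 0.
    transitivity (d * (l1 * a + l2 * b - (m1 * a + m2 * b))
      - b * (l1 * c + l2 * d - (m1 * c + m2 * d))); first by rewrite /e; ring.
    by rewrite Eu Ev; ring.
  have F2 : (l2 - m2) * e = 0.
    transitivity (a * (l1 * c + l2 * d - (m1 * c + m2 * d))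
      - c * (l1 * a + l2 * b - (m1 * a + m2 * b))); first by rewrite /e; ring.
    by rewrite Eu Ev; ring.
  by move/eqP: F1; move/eqP: F2; rewrite !mulf_eq0 (gt_eqF e0) !orbF !subr_eq0
    => /eqP -> /eqP ->.
rewrite -(ltr_pM2l pq0) -envelopeZ ?addr_ge0 //.
have -> : (p + q) * (a + c) = e * i%:R + p * c by rewrite En; ring.
have -> : (p + q) * (b + d) = e * j%:R + p * d by rewrite Ek; ring.
have := envelopeD (mulr_ge0 (ltW e0) (ler0n R i)) (mulr_ge0 (ltW e0) (ler0n R j))
  (mulr_ge0 (ltW p0) c0) (mulr_ge0 (ltW p0) d0).
rewrite !envelopeZ ?ler0n //; move: strict.
by set u := envelope a b; set v := envelope c d; lra.
Qed.

Let pos (a : R) := Num.max a 0.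

(** One nearly optimal form bounds the envelope from above near (a, b). From below, clamped points
    near (a, b) are at least t times the clamped (a, b) in each coordinate, and monotonicity with
    homogeneity gives the bound t g, on the axes too. *)
Lemma envelope_continuous :
  continuous (fun p : R * R => envelope (pos p.1) (pos p.2)).
Proof.
have pos0 a : 0 <= pos a by rewrite le_max lexx orbT.
have cpos (g : R * R -> R) : continuous g -> continuous (fun p => pos (g p)).
  by move=> cg p; apply: (@continuous_max R _ g (fun=> 0)); [exact: cg|exact: cst_continuous].
have c1 : continuous (fun p : R * R => pos p.1) by apply: cpos => p; exact: cvg_fst.
have c2 : continuous (fun p : R * R => pos p.2) by apply: cpos => p; exact: cvg_snd.
move=> [a b]; apply/cvgrPdist_lt => e e0 /=.
set g := envelope (pos a) (pos b).
have g0 : 0 <= g by exact: envelope_ge0.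
have [l dl hl] := envelope_adherent (pos0 a) (pos0 b) e0.
(* (g - e)(g + e) < g^2 gives g - e < t g; t < 1 leaves room at each positive coordinate, and a zero
   coordinate imposes nothing. *)
pose t := g / (g + e).
have ge0 : 0 < g + e by rewrite ltr_wpDl.
have t0 : 0 <= t by rewrite divr_ge0 // ltW.
have t1 : t < 1 by rewrite ltr_pdivrMr // mul1r ltrDl.
have tg : g - e < t * g.
  by rewrite /t mulrAC ltr_pdivlMr //; nra.
have nearpos (f : R * R -> R) : continuous f -> (forall p, 0 <= f p) ->
    \forall p \near (nbhs (a, b)), t * f (a, b) <= f p.
  move=> cf f0; have := f0 (a, b); rewrite le_eqVlt => /predU1P[<-|fp].
    by near=> p; rewrite mulr0.
  by apply: filterS (cvgr_gt _ (cf (a, b)) (t * f (a, b)) _) => [p /ltW //|];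
    rewrite gtr_pMl.
near=> p.
rewrite distrC ltr_distl; apply/andP; split.
- apply: lt_le_trans tg _; rewrite -/g.
  have [tp|] := ltrP 0 t; last first.
    move=> ?; have -> : t = 0 by lra.
    by rewrite mul0r envelope_ge0.
  rewrite -envelopeZ //; apply: envelope_mono.
  + exact: mulr_ge0.
  + exact: mulr_ge0.
  + by near: p; exact: (nearpos _ c1).
  + by near: p; exact: (nearpos _ c2).
- apply: le_lt_trans (envelope_le (pos0 _) (pos0 _) dl) _.
  near: p; apply: (@cvgr_lt _ _ _ _ (fun p : R * R => ev l (pos p.1) (pos p.2))
    (ev l (pos a) (pos b))) => //.
  by apply: cvgD; apply: cvgMr; [exact: (c1 (a, b))|exact: (c2 (a, b))].
Unshelve. all: by end_near.
Qed.

End Envelope.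

(** * Labels of a topograph *)

Lemma left_rev (T : plane_cubic_tree) (d : dart T) :
  left (Defs.rev d) = left (Defs.rot (Defs.rot d)).
Proof. by apply/left_eq; exists 1%N; left; rewrite /= Defs.revK. Qed.

Lemma discriminator_rot (R : realType) (G : markov_topograph R) (d : dart G) :
  discriminator (Defs.rot d) = discriminator d.
Proof. by rewrite /discriminator rot3; ring. Qed.

Lemma discriminator_rev (R : realType) (G : markov_topograph R) (d : dart G) :
  discriminator (Defs.rev d) = discriminator d.
Proof.
rewrite /discriminator -!left_rev Defs.revK; have := edge_rule d.
set r := label (left (Defs.rot d)); set u := label (left (Defs.rot (Defs.rev d))).
set s := label (left d); set t := label (left (Defs.rev d)) => E.
have -> : u = s * t - r by rewrite -E; ring.
by ring.
Qed.

Lemma discriminator_const (R : realType) (G : markov_topograph R) (d d' : dart G) :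
  discriminator d' = discriminator d.
Proof.
have [w ->] := tree_connected d d'; elim: w d => //= b w IH d.
by rewrite IH; case: b; rewrite ?discriminator_rev ?discriminator_rot.
Qed.

Lemma discriminator_well (R : realType) (G : markov_topograph R) (v d : dart G) :
  negative_vertex_well v -> 20 <= discriminator d.
Proof.
rewrite (discriminator_const v d) /discriminator => -[].
move: (label _) (label _) (label _) => r s t hr hs ht.
have rs : 4 <= r * s by nra.
have : 8 <= - (r * s * t) by nra.
by nra.
Qed.

Section Labels.
Variables (R : realType) (G : markov_topograph R) (f : int -> int -> region G).
Hypothesis hfarey : farey_indexing f.
Hypothesis hlabel : forall x : region G, label x <= -2 \/ 2 <= label x.

(* Regions are indexed by vectors [(n, k)], standing for [k/n]. *)
Definition vlabel (u : int * int) : R := mstar f u.2 u.1.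
Definition edge_pair (u w : int * int) : Prop := exists d : dart G,
  has_index f (left d) u.2 u.1 /\ has_index f (left (Defs.rev d)) w.2 w.1.

Lemma vlabelN u : coprimez u.2 u.1 -> vlabel (- u) = vlabel u.
Proof. by move=> co; rewrite /vlabel /mstar /= farey_opp. Qed.

Lemma vlabel_norm u : 2 <= `|vlabel u|.
Proof. by rewrite ler_normr /vlabel /mstar; case: (hlabel (f u.2 u.1)); lra. Qed.

Lemma edge_pairC u w : edge_pair u w -> edge_pair w u.
Proof. by move=> [d [h1 h2]]; exists (Defs.rev d); rewrite Defs.revK. Qed.

Lemma edge_pair_coprime u w : edge_pair u w -> coprimez u.2 u.1.
Proof. by move=> [d [[]]]. Qed.

Lemma edge_pairN u w : edge_pair u w -> edge_pair u (- w).
Proof.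
move=> [d [h1 [co E]]]; exists d; split=> //; split=> /=.
  by rewrite coprimeNz coprimezN.
by rewrite farey_opp.
Qed.

(** The region u + w sits at one of the two ends of the edge; the dart sought enters or leaves that
    vertex along the edge between u and u + w. *)
Lemma edge_pairD u w : edge_pair u w -> edge_pair u (u + w).
Proof.
move=> [d [h1 h2]]; case: (farey_edge hfarey h1 h2) => -[h3 h4].
- by exists (Defs.rev (Defs.rot d)); rewrite Defs.revK left_rev rot3.
- by exists (Defs.rot (Defs.rot (Defs.rev d))); rewrite -left_rev Defs.revK left_rev rot3.
Qed.

Lemma vlabelD u w : edge_pair u w ->
  vlabel (u + w) + vlabel (u - w) = vlabel u * vlabel w.
Proof.
move=> [d [h1 h2]]; rewrite /vlabel /mstar /= -(proj2 h1) -(proj2 h2) -edge_rule.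
by case: (farey_edge hfarey h1 h2) => -[[_ ->] [_ ->]] //; rewrite addrC.
Qed.

Definition sector_vector (p q : int * int) (v : nat * nat) : int * int :=
  p *+ v.1 + q *+ v.2.

Lemma sector_vectorD p q x y :
  sector_vector p q (x + y) = sector_vector p q x + sector_vector p q y.
Proof. by rewrite /sector_vector /= !mulrnDr addrACA. Qed.

(* Away from the well the product of the labels at a vertex is positive, so that
   taking absolute values preserves the rule [X * W - Y]. *)
Lemma sector_labelsP p q : edge_pair p q ->
  vlabel p <= -2 -> vlabel q <= -2 -> vlabel (p - q) <= -2 ->
  sector_labels
    (vlabel p ^+ 2 + vlabel q ^+ 2 + vlabel (p - q) ^+ 2
      - vlabel p * vlabel q * vlabel (p - q))
    (fun v => `|vlabel (sector_vector p q v)|).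
Proof.
move=> pq hp hq hpq; set D := _ - _ * _; set W := sector_vector p q; split.
  move: hp hq hpq; rewrite /D; move: (vlabel p) (vlabel q) (vlabel (p - q)) => r s t hr hs ht.
  have rs : 4 <= r * s by nra.
  have : 8 <= - (r * s * t) by nra.
  by nra.
have step x y : edge_pair (W x) (W y) -> vlabel (W (x + (x + y))) =
    vlabel (W x) * vlabel (W (x + y)) - vlabel (W y).
  move=> e; have e' := edge_pairD e.
  rewrite /W !sector_vectorD -/W -(vlabelD e').
  have -> : W x - (W x + W y) = - W y by rewrite opprD addrA subrr add0r.
  by rewrite vlabelN ?addrK //; apply: edge_pair_coprime (edge_pairC e).
have norm_step (a b c : R) : 0 < a * b * c -> `|b| <= `|a| * `|c| ->
    `|a * c - b| = `|a| * `|c| - `|b|.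
  rewrite -normrM => h; have abc : 0 < (a * c) * b by rewrite mulrAC.
  case: (ltrgt0P (a * c)) => ac; move: abc; rewrite ?ac ?mul0r ?ltxx //.
  - rewrite pmulr_rgt0 // => b0; rewrite (gtr0_norm b0) => le.
    by rewrite ger0_norm // subr_ge0.
  - rewrite nmulr_rgt0 // => b0; rewrite (ltr0_norm b0) => le.
    by rewrite ler0_norm; lra.
(* The sign invariant holds at the root because the label of p + q is X * Y - Z, which is positive,
   X, Y, Z being the negative labels of p, q, p - q. *)
have inv x y : farey_pair x y -> [/\ edge_pair (W x) (W y),
    growing D `|vlabel (W x)| `|vlabel (W y)| `|vlabel (W (x + y))| &
    0 < vlabel (W x) * vlabel (W y) * vlabel (W (x + y))].
  elim=> [|{}x {}y _ [e g h]|{}x {}y _ [e g h]].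
  - have Wp : W (1, 0)%N = p by rewrite /W /sector_vector /= mulr1n mulr0n addr0.
    have Wq : W (0, 1)%N = q by rewrite /W /sector_vector /= mulr1n mulr0n add0r.
    rewrite /W sector_vectorD -/W Wp Wq; split=> //.
      have := vlabelD pq; move: hp hq hpq; rewrite /D /growing.
      move: (vlabel p) (vlabel q) (vlabel (p - q)) (vlabel (p + q)) => X Y Z U hX hY hZ E.
      have {E} -> : U = X * Y - Z by rewrite -E addrK.
      have XY : 4 <= X * Y by nra.
      have -> : `|X| = - X by rewrite ler0_norm //; lra.
      have -> : `|Y| = - Y by rewrite ler0_norm //; lra.
      have -> : `|X * Y - Z| = X * Y - Z by rewrite ger0_norm //; lra.
      by split; [lra|lra|lra|ring].
    have := vlabelD pq; move: hp hq hpq.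
    move: (vlabel p) (vlabel q) (vlabel (p - q)) (vlabel (p + q)) => X Y Z U hX hY hZ E.
    have {E} -> : U = X * Y - Z by rewrite -E addrK.
    have XY : 4 <= X * Y by nra.
    by apply: mulr_gt0; lra.
  - split; first exact: edge_pairC.
      by rewrite [y + x]addrC; apply: growingC.
    by rewrite [y + x]addrC [_ * vlabel (W x)]mulrC.
  - have e' : edge_pair (W x) (W (x + y)).
      by rewrite /W sector_vectorD; apply: edge_pairD.
    have bnd : `|vlabel (W y)| < `|vlabel (W x)| * `|vlabel (W (x + y))|.
      apply: lt_le_trans (growing_ltr g) _; rewrite ler_peMl //.
      by apply: le_trans (vlabel_norm (W x)); lra.
    split=> //; rewrite (step _ _ e).
      by rewrite norm_step ?(ltW bnd) //; apply: growing_step.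
    rewrite -normrM in bnd; move: h bnd; rewrite mulrAC.
    set a := vlabel (W x) * vlabel (W (x + y)); set b := vlabel (W y) => h bnd.
    by case: (ltrgt0P a) bnd h => a0; case: (ltrgt0P b) => b0; nra.
move=> x y xy; have [e g h] := inv _ _ xy; split=> //.
rewrite step // norm_step //; apply: ltW; apply: lt_le_trans (growing_ltr g) _.
by rewrite ler_peMl //; apply: le_trans (vlabel_norm (W x)); lra.
Qed.

End Labels.

Section Centre.
Variables (R : realType) (G : markov_topograph R) (f : int -> int -> region G).
Variable v : dart G.
Hypothesis hfarey : farey_indexing f.
Hypothesis hcentre : centred_at f v.

Lemma edge_pair_centre : edge_pair f (1, 0) (0, 1).
Proof.
case: hcentre => h0 _ h2; exists v; split; split=> //=.
by rewrite left_rev.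
Qed.

Lemma edge_pair_sector0 : edge_pair f (1, 0) (1, 1).
Proof. exact: (edge_pairD hfarey edge_pair_centre). Qed.

Lemma edge_pair_sector1 : edge_pair f (1, 1) (0, 1).
Proof. exact: (edge_pairC (edge_pairD hfarey (edge_pairC edge_pair_centre))). Qed.

(** The region 0/1 enters with the sign for which the difference of the generators is [(1, 1)], the
    third central region; the sector is then the second quadrant. *)
Lemma edge_pair_sector2 : edge_pair f (0, 1) (-1, 0).
Proof. exact: (edge_pairN hfarey (edge_pairC edge_pair_centre)). Qed.

End Centre.

(** * Gluing the sectors *)

(** The properties of an envelope on which the gluing relies. Clamping the arguments turns
    continuity on the closed quadrant into continuity on the plane. *)
Record quadrant_gauge (R : realType) (E : R -> R -> R) : Prop := QuadrantGauge {
  qgZ : forall c a b : R, 0 <= a -> 0 <= b -> 0 < c -> E (c * a) (c * b) = c * E a b;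
  qg00 : E 0 0 = 0;
  qg_ge0 : forall a b : R, 0 <= a -> 0 <= b -> 0 <= E a b;
  qgD_lt : forall a b c d : R, 0 <= a -> 0 <= b -> 0 <= c -> 0 <= d ->
    a * d - b * c != 0 -> E a b + E c d < E (a + c) (b + d);
  qg_continuous :
    continuous (fun p : R * R => E (Num.max p.1 0) (Num.max p.2 0)) }.

Lemma envelope_gauge (R : realType) (D : R) M :
  sector_labels D M -> quadrant_gauge (envelope M).
Proof.
move=> HM; split.
- exact: envelopeZ HM.
- exact: envelope00 HM.
- exact: envelope_ge0 HM.
- exact: envelopeD_lt HM.
- exact: envelope_continuous HM.
Qed.

Section Defect.
Variables (R : realType) (E : R -> R -> R).
Hypothesis HE : quadrant_gauge E.
Implicit Types a b c x : R.
Let pos a := Num.max a 0.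

Lemma qg_axis1 a : 0 <= a -> E a 0 = a * E 1 0.
Proof.
rewrite le_eqVlt => /predU1P[<-|a0]; first by rewrite mul0r qg00.
by rewrite -(qgZ HE) ?mulr1 ?mulr0.
Qed.

Lemma qg_axis2 a : 0 <= a -> E 0 a = a * E 0 1.
Proof.
rewrite le_eqVlt => /predU1P[<-|a0]; first by rewrite mul0r qg00.
by rewrite -(qgZ HE) ?mulr1 ?mulr0.
Qed.

(** The two axis components of (a, b) are independent, so its value strictly exceeds a nonnegative
    sum. *)
Lemma qg_gt0 a b : 0 < a -> 0 < b -> 0 < E a b.
Proof.
move=> a0 b0; have := @qgD_lt _ _ HE a 0 0 b; rewrite mulr0 subr0 addr0 add0r.
move/(_ (ltW a0) (lexx _) (lexx _) (ltW b0)); rewrite mulf_neq0 ?gt_eqF // => /(_ isT).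
by apply: le_lt_trans; rewrite addr_ge0 // (qg_ge0 HE) // ltW.
Qed.

(* Vanishes outside the open quadrant, so that these can be glued by addition. *)
Definition defect a b : R := E (pos a) (pos b) - pos a * E 1 0 - pos b * E 0 1.

Lemma posE a : 0 <= a -> pos a = a. Proof. by move=> ?; exact/max_idPl. Qed.
Lemma posN a : a <= 0 -> pos a = 0. Proof. by move=> ?; exact/max_idPr. Qed.
Lemma pos_ge0 a : 0 <= pos a. Proof. by rewrite le_max lexx orbT. Qed.

Lemma defect_in a b : 0 <= a -> 0 <= b -> defect a b = E a b - a * E 1 0 - b * E 0 1.
Proof. by move=> a0 b0; rewrite /defect !posE. Qed.

Lemma defect_out1 a b : a <= 0 -> defect a b = 0.
Proof.
by move=> a0; rewrite /defect (posN a0) mul0r subr0 qg_axis2 ?pos_ge0 ?subrr.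
Qed.

Lemma defect_out2 a b : b <= 0 -> defect a b = 0.
Proof.
by move=> b0; rewrite /defect (posN b0) mul0r subr0 qg_axis1 ?pos_ge0 ?subrr.
Qed.

Lemma defect_continuous (g h : R * R -> R) : continuous g -> continuous h ->
  continuous (fun p => defect (g p) (h p)).
Proof.
move=> cg ch p; have cpos (k : R * R -> R) : continuous k -> continuous (fun p => pos (k p)).
  by move=> ck q; apply: (@continuous_max R _ k (fun=> 0)); [exact: ck|exact: cst_continuous].
have c1 := cpos _ cg; have c2 := cpos _ ch.
apply: cvgB; last by apply: cvgM; [exact: c2|exact: cvg_cst].
apply: cvgB; last by apply: cvgM; [exact: c1|exact: cvg_cst].
apply: (@continuous_comp _ _ _ (fun p => (g p, h p)) (fun p => E (pos p.1) (pos p.2))).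
  exact: (cvg_pair (cg p) (ch p)).
exact: (qg_continuous HE).
Qed.

End Defect.

Section Gluing.
Variables (R : realType) (E0 E1 E2 : R -> R -> R) (h0 h1 h2 : R).
Hypotheses (H0 : quadrant_gauge E0) (H1 : quadrant_gauge E1)
  (H2 : quadrant_gauge E2).
Hypotheses (E00 : E0 1 0 = h0) (E01 : E0 0 1 = h1) (E10 : E1 1 0 = h1)
  (E11 : E1 0 1 = h2) (E20 : E2 1 0 = h2) (E21 : E2 0 1 = h0).
Implicit Types x y z t c : R.

Definition sector (s : nat) x y : Prop :=
  match s with
  | 0%N => 0 <= y <= x
  | 1%N => 0 <= x <= y
  | _ => x <= 0 <= y
  end.

(** The defects take coordinates in the six sector bases, and at most one is nonzero at a point. The
    combination of |x|, |y|, |x - y| is the even function, linear on each sector, with values h0,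
    h1, h2 at (1, 0), (1, 1), (0, 1). Being a sum of continuous terms, the whole needs no pasting
    along the rays. *)
Definition sector_glue x y : R :=
  defect E0 (x - y) y + defect E0 (y - x) (- y) +
  (defect E1 x (y - x) + defect E1 (- x) (x - y)) +
  (defect E2 y (- x) + defect E2 (- y) x) +
  ((h0 + h1 - h2) / 2 * `|x| + (h2 + h1 - h0) / 2 * `|y| +
   (h0 + h2 - h1) / 2 * `|x - y|).

Lemma sector_glueN x y : sector_glue (- x) (- y) = sector_glue x y.
Proof.
have e1 : - x - - y = y - x by ring.
have e2 : - y - - x = x - y by ring.
by rewrite /sector_glue e1 e2 !opprK !normrN [`|y - x|]distrC; ring.
Qed.

Lemma sector_glue0 x y : sector 0 x y -> sector_glue x y = E0 (x - y) y.
Proof.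
case/andP=> y0 yx; have x0 := le_trans y0 yx.
rewrite /sector_glue (defect_in E0) ?subr_ge0 // E00 E01.
rewrite (defect_out1 H0) ?subr_le0 // (defect_out2 H1) ?subr_le0 //.
rewrite (defect_out1 H1) ?oppr_le0 // (defect_out2 H2) ?oppr_le0 //.
rewrite (defect_out1 H2) ?oppr_le0 // !ger0_norm ?subr_ge0 //.
by field.
Qed.

Lemma sector_glue1 x y : sector 1 x y -> sector_glue x y = E1 x (y - x).
Proof.
case/andP=> x0 xy; have y0 := le_trans x0 xy.
rewrite /sector_glue (defect_in E1) ?subr_ge0 // E10 E11.
rewrite (defect_out1 H0) ?subr_le0 // (defect_out2 H0) ?oppr_le0 //.
rewrite (defect_out1 H1) ?oppr_le0 // (defect_out2 H2) ?oppr_le0 //.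
rewrite (defect_out1 H2) ?oppr_le0 // (ger0_norm x0) (ger0_norm y0).
rewrite ler0_norm ?subr_le0 //.
by field.
Qed.

Lemma sector_glue2 x y : sector 2 x y -> sector_glue x y = E2 y (- x).
Proof.
case/andP=> x0 y0; have xy := le_trans x0 y0.
rewrite /sector_glue (defect_in E2) ?oppr_ge0 // E20 E21.
rewrite (defect_out1 H0) ?subr_le0 // (defect_out2 H0) ?oppr_le0 //.
rewrite (defect_out1 H1) // (defect_out2 H1) ?subr_le0 //.
rewrite (defect_out1 H2) ?oppr_le0 // (ler0_norm x0) (ger0_norm y0).
rewrite ler0_norm ?subr_le0 //.
by field.
Qed.

Lemma sector_cover x y : exists2 s, (s < 3)%N & sector s x y \/ sector s (- x) (- y).
Proof.
case: (lerP 0 x) => x0; case: (lerP 0 y) => y0.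
- by case: (leP y x) => xy; [exists 0%N|exists 1%N] => //; left; apply/andP; split; lra.
- by exists 2%N => //; right; apply/andP; split; lra.
- by exists 2%N => //; left; apply/andP; split; lra.
- by case: (leP y x) => xy; [exists 1%N|exists 0%N] => //; right; apply/andP; split; lra.
Qed.

Lemma sector_glue_continuous : continuous (fun p : R * R => sector_glue p.1 p.2).
Proof.
have c1 : continuous (fun p : R * R => p.1) by move=> p; exact: cvg_fst.
have c2 : continuous (fun p : R * R => p.2) by move=> p; exact: cvg_snd.
have cN (g : R * R -> R) : continuous g -> continuous (fun p => - g p).
  by move=> cg p; apply: cvgN; exact: cg.
have cB (g h : R * R -> R) : continuous g -> continuous h -> continuous (fun p => g p - h p).
  by move=> cg ch p; apply: cvgB; [exact: cg|exact: ch].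
have cD (g h : R * R -> R) : continuous g -> continuous h -> continuous (fun p => g p + h p).
  by move=> cg ch p; apply: cvgD; [exact: cg|exact: ch].
have cZ k (g : R * R -> R) : continuous g -> continuous (fun p => k * `|g p|).
  by move=> cg p; apply: cvgM; first exact: cvg_cst; apply: cvg_norm; exact: cg.
have c12 := cB _ _ c1 c2; have c21 := cB _ _ c2 c1.
have d0 := cD _ _ (defect_continuous H0 c12 c2) (defect_continuous H0 c21 (cN _ c2)).
have d1 := cD _ _ (defect_continuous H1 c1 c21) (defect_continuous H1 (cN _ c1) c12).
have d2 := cD _ _ (defect_continuous H2 c2 (cN _ c1)) (defect_continuous H2 (cN _ c2) c1).
exact: (cD _ _ (cD _ _ (cD _ _ d0 d1) d2)
  (cD _ _ (cD _ _ (cZ _ _ c1) (cZ _ _ c2)) (cZ _ _ c12))).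
Qed.

Lemma sector_glueZ c x y : 0 < c -> sector_glue (c * x) (c * y) = c * sector_glue x y.
Proof.
move=> c0; have [s s3] := sector_cover x y.
wlog S : x y / sector s x y.
  move=> wl [S|S]; first by apply: wl => //; left.
  by rewrite -sector_glueN -!mulrN wl ?sector_glueN //; left.
move=> _; have cge t : (0 <= c * t) = (0 <= t) by rewrite pmulr_rge0.
have cle t : (c * t <= 0) = (t <= 0) by rewrite pmulr_rle0.
case: s s3 S => [|[|[|//]]] _ S.
- rewrite !sector_glue0 //; last first.
    by case/andP: S => ? ?; rewrite /sector cge ler_pM2l //; apply/andP.
  by rewrite -mulrBr; case/andP: S => ? ?; rewrite (qgZ H0) ?subr_ge0.
- rewrite !sector_glue1 //; last first.
    by case/andP: S => ? ?; rewrite /sector cge ler_pM2l //; apply/andP.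
  by rewrite -mulrBr; case/andP: S => ? ?; rewrite (qgZ H1) ?subr_ge0.
- rewrite !sector_glue2 //; last first.
    by case/andP: S => ? ?; rewrite /sector cge cle //; apply/andP.
  by rewrite -mulrN; case/andP: S => ? ?; rewrite (qgZ H2) ?oppr_ge0.
Qed.

Lemma sector_glue_ge0 x y : 0 <= sector_glue x y.
Proof.
have [s s3] := sector_cover x y.
wlog S : x y / sector s x y.
  move=> wl [S|S]; first by apply: wl => //; left.
  by rewrite -sector_glueN; apply: wl => //; left.
move=> _; case: s s3 S => [|[|[|//]]] _ S; move: (S) => /andP[? ?].
- by rewrite sector_glue0 // (qg_ge0 H0) // subr_ge0.
- by rewrite sector_glue1 // (qg_ge0 H1) // subr_ge0.
- by rewrite sector_glue2 // (qg_ge0 H2) // oppr_ge0.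
Qed.

Lemma sectorD s x y z t : sector s x y -> sector s z t -> sector s (x + z) (y + t).
Proof.
by case: s => [|[|s]] /andP[? ?] /andP[? ?]; apply/andP; split; lra.
Qed.

Lemma sector_glueD_lt s x y z t : sector s x y -> sector s z t -> 0 < x * t - y * z ->
  sector_glue x y + sector_glue z t < sector_glue (x + z) (y + t).
Proof.
move=> S T xyzt; have ST := sectorD S T.
case: s S T ST => [|[|s]] S T ST.
- rewrite !sector_glue0 //; case/andP: S => ? ?; case/andP: T => ? ?.
  have -> : x + z - (y + t) = x - y + (z - t) by ring.
  apply: (qgD_lt H0); rewrite ?subr_ge0 //.
  have -> : (x - y) * t - y * (z - t) = x * t - y * z by ring.
  by rewrite gt_eqF.
- rewrite !sector_glue1 //; case/andP: S => ? ?; case/andP: T => ? ?.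
  have -> : y + t - (x + z) = y - x + (t - z) by ring.
  apply: (qgD_lt H1); rewrite ?subr_ge0 //.
  have -> : x * (t - z) - (y - x) * z = x * t - y * z by ring.
  by rewrite gt_eqF.
- have S' : sector 2 x y by []. have T' : sector 2 z t by [].
  have ST' : sector 2 (x + z) (y + t) by [].
  rewrite !sector_glue2 //; case/andP: S => ? ?; case/andP: T => ? ?.
  rewrite opprD; apply: (qgD_lt H2); rewrite ?oppr_ge0 //.
  have -> : y * - z - - x * t = x * t - y * z by ring.
  by rewrite gt_eqF.
Qed.

Lemma sector_glue_eq0 x y : sector_glue x y = 0 -> [|| x == 0, y == 0 | x == y].
Proof.
have [s s3] := sector_cover x y.
wlog S : x y / sector s x y.
  move=> wl [S|S]; first exact: (wl _ _ S (or_introl S)).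
  by rewrite -sector_glueN => /(wl _ _ S (or_introl S)); rewrite !oppr_eq0 eqr_opp.
move=> _ g0; apply: contraT; rewrite !negb_or => /and3P[x0 y0 xy].
case: s s3 S => [|[|[|//]]] _ S; move: (S) => /andP[].
- rewrite !le_eqVlt ![0 == _]eq_sym (negPf y0) [y == x]eq_sym (negPf xy) /= => yp yx.
  by have := @qg_gt0 _ _ H0 (x - y) y; rewrite -sector_glue0 // g0 ltxx subr_gt0 => /(_ yx yp).
- rewrite !le_eqVlt ![0 == _]eq_sym (negPf x0) (negPf xy) /= => xp xy'.
  have := @qg_gt0 _ _ H1 x (y - x).
  by rewrite -sector_glue1 // g0 ltxx subr_gt0 => /(_ xp xy').
- rewrite !le_eqVlt ![0 == _]eq_sym (negPf x0) (negPf y0) /= => xn yp.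
  by have := @qg_gt0 _ _ H2 y (- x); rewrite -sector_glue2 // g0 ltxx oppr_gt0 => /(_ yp xn).
Qed.

End Gluing.

(** * Polar curves *)

Section Angles.
Variable R : realType.
Implicit Types x y a b c r theta : R.

Lemma polar_coordinates x y : (x != 0) || (y != 0) ->
  exists theta r : R, [/\ 0 < r, x = r * cos theta & y = r * sin theta].
Proof.
move=> xy0; pose r := Num.sqrt (x ^+ 2 + y ^+ 2).
have s0 : 0 < x ^+ 2 + y ^+ 2.
  by rewrite lt_neqAle eq_sym addr_ge0 ?sqr_ge0 // andbT paddr_eq0 ?sqr_ge0 //
    !sqrf_eq0 negb_and.
have r0 : 0 < r by rewrite sqrtr_gt0.
have r2 : r ^+ 2 = x ^+ 2 + y ^+ 2 by rewrite sqr_sqrtr // ltW.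
have t1 : -1 <= x / r <= 1.
  rewrite -ler_norml -(@ler_pXn2r _ 2) ?nnegrE // expr1n real_normK ?num_real //.
  by rewrite expr_div_n r2 ler_pdivrMr // mul1r lerDl sqr_ge0.
have Ec : x = r * cos (acos (x / r)).
  by rewrite acosK ?in_itv //= mulrC divfK // gt_eqF.
have Es : `|y| = r * sin (acos (x / r)).
  rewrite sin_acos // -(sqrtr_sqr y).
  have -> : y ^+ 2 = r ^+ 2 * (1 - (x / r) ^+ 2).
    rewrite mulrBr mulr1 expr_div_n mulrCA divff ?mulr1.
      by rewrite r2 addrAC subrr add0r.
    by rewrite expf_neq0 // gt_eqF.
  by rewrite sqrtrM ?sqr_ge0 // sqrtr_sqr gtr0_norm.
case: (lerP 0 y) => y0.
- by exists (acos (x / r)), r; rewrite -Ec -Es ger0_norm.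
- by exists (- acos (x / r)), r; rewrite cosN sinN -Ec mulrN -Es ltr0_norm // opprK.
Qed.

Lemma cos_eq1_2pi x : cos x = 1 -> 0 <= x -> x < 2 * pi -> x = 0.
Proof.
have p0 := @pi_gt0 R; move=> c1 x0 x2; case: (lerP x pi) => xp.
  by apply: cos_inj; rewrite ?in_itv /= ?lexx ?x0 ?xp ?(ltW p0) // cos0.
have : 2 * pi - x = 0.
  apply: cos_inj; rewrite ?in_itv /= ?lexx ?(ltW p0) //; first by apply/andP; split; lra.
  by rewrite cos0 -cosN opprB mulr_natl -(cosD2pi (x - _)) subrK.
by lra.
Qed.

Lemma periodic_int (T : Type) (g : R -> T) p (z : int) a :
  (forall t, g (t + p) = g t) -> g (a + z%:~R * p) = g a.
Proof.
move=> hg; have hn (n : nat) t : g (t + n%:R * p) = g t.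
  elim: n t => [|n IH] t; first by rewrite mul0r addr0.
  by rewrite -natr1 mulrDl mul1r addrA hg.
case: z => n; first by rewrite -pmulrn.
by rewrite NegzE mulrNz mulNr; have := hn n.+1 (a - n.+1%:R * p); rewrite subrK => ->.
Qed.

Lemma periodic_angle (T : Type) (g : R -> T) a b : (forall t, g (t + 2 * pi) = g t) ->
  cos a = cos b -> sin a = sin b -> g a = g b.
Proof.
move=> hg Ec Es; have p0 : 0 < 2 * pi :> R by rewrite mulr_gt0 // pi_gt0.
(* Removing whole turns brings a - b into [0, 2 pi), where only 0 has cosine 1. *)
pose z := Num.floor ((a - b) / (2 * pi)).
have /andP[] : z%:~R <= (a - b) / (2 * pi) < (z + 1)%:~R.
  by rewrite real_floor_itv // num_real.
rewrite ler_pdivlMr // ltr_pdivrMr // intrD (mulrDl z%:~R) [1%:~R * _]mul1r => z1 z2.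
have : a - b - z%:~R * (2 * pi) = 0.
  apply: cos_eq1_2pi; rewrite ?subr_ge0 ?ltrBlDl ?addrA //; last by lra.
  rewrite -mulNr -intrN (@periodic_int _ (@cos R)); last first.
    by move=> t; rewrite mulr_natl cosD2pi.
  by rewrite cosB Ec Es -!expr2 cos2Dsin2.
move=> E; have -> : a = b + z%:~R * (2 * pi) by lra.
exact: periodic_int.
Qed.

Lemma cos_sub_sin_quarter theta :
  exists2 c : R, 0 < c & sin (pi / 4 - theta) = c * (cos theta - sin theta).
Proof.
have p0 := @pi_gt0 R; exists (sin (pi / 4)); first by apply: sin_gt0_pi; lra.
have E : cos (pi / 4) = sin (pi / 4) :> R.
  by rewrite -cosBpihalf -[in LHS]cosN; congr cos; field.
by rewrite sinB E mulrBr.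
Qed.

Lemma sin_le_cos theta : 0 <= theta <= pi / 4 -> sin theta <= cos theta.
Proof.
have p0 := @pi_gt0 R; move=> /andP[t0 t1].
have [c c0 E] := cos_sub_sin_quarter theta.
by rewrite -subr_ge0 -(pmulr_rge0 _ c0) -E sin_ge0_pi //; apply/andP; split; lra.
Qed.

Lemma cos_le_sin theta : pi / 4 <= theta <= pi / 2 -> cos theta <= sin theta.
Proof.
have p0 := @pi_gt0 R; move=> /andP[t0 t1].
have [c c0 E] := cos_sub_sin_quarter theta.
rewrite -subr_le0 -(pmulr_rle0 _ c0) -E -oppr_ge0 -sinN opprB.
by rewrite sin_ge0_pi //; apply/andP; split; lra.
Qed.

Lemma cos_le0 theta : pi / 2 <= theta <= pi -> cos theta <= 0.
Proof.
have p0 := @pi_gt0 R; move=> /andP[t0 t1].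
rewrite -[theta](subrK (pi / 2)) cosDpihalf oppr_le0 sin_ge0_pi //.
by apply/andP; split; lra.
Qed.

Lemma rational_direction a b : a < b -> b - a < pi -> exists2 theta, a <= theta <= b &
  exists (n k : int) (l : R),
    [/\ coprimez k n, 0 < l, n%:~R = l * cos theta & k%:~R = l * sin theta].
Proof.
move=> ab bap; have d0 : 0 < cos a * sin b - sin a * cos b.
  by rewrite mulrC [_ * cos b]mulrC -sinB sin_gt0_pi // subr_gt0 ab.
have [n [k [co h1 h2]]] := coprimez_in_cone d0.
have [theta th E] : exists2 t, t \in `[a, b] & cos t * k%:~R - sin t * n%:~R = 0 :> R.
  apply: (IVT (ltW ab)).
    apply: continuous_subspaceT => t; apply: cvgB; apply: cvgM;
      [exact: continuous_cos|exact: cvg_cst|exact: continuous_sin|exact: cvg_cst].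
  rewrite ge_min le_max (ltW h1) andbT; apply/orP; right.
  by rewrite -oppr_ge0 opprB mulrC [cos b * _]mulrC ltW.
exists theta; first by rewrite in_itv in th.
pose m := n%:~R * cos theta + k%:~R * sin theta.
have cs := cos2Dsin2 theta.
have En : n%:~R = m * cos theta.
  transitivity (n%:~R * (cos theta ^+ 2 + sin theta ^+ 2)); first by rewrite cs mulr1.
  transitivity (m * cos theta - (cos theta * k%:~R - sin theta * n%:~R) * sin theta).
    by rewrite /m; ring.
  by rewrite E mul0r subr0.
have Ek : k%:~R = m * sin theta.
  transitivity (k%:~R * (cos theta ^+ 2 + sin theta ^+ 2)); first by rewrite cs mulr1.
  transitivity (m * sin theta + (cos theta * k%:~R - sin theta * n%:~R) * cos theta).
    by rewrite /m; ring.
  by rewrite E mul0r addr0.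
(* The angle found lies on the line of (n, k); the sign of m tells whether (n, k) or its opposite
   points that way. *)
case: (ltrgt0P m) => m0.
- by exists n, k, m.
- exists (- n), (- k), (- m); split; rewrite ?coprimezN ?coprimeNz ?oppr_gt0 //.
    by rewrite mulrNz En mulNr.
  by rewrite mulrNz Ek mulNr.
- move: h1; rewrite En Ek m0 !mul0r !mulr0 subrr ltxx //.
Qed.

End Angles.

(** * Curves F = 1 for a nonnegative, homogeneous, continuous F *)

Section PolarGauge.
Variables (R : realType) (F : R -> R -> R).
Hypothesis FZ : forall c x y : R, 0 < c -> F (c * x) (c * y) = c * F x y.
Hypothesis F_ge0 : forall x y : R, 0 <= F x y.
Hypothesis F_continuous : continuous (fun p : R * R => F p.1 p.2).
Implicit Types theta : R.

Definition gauge_radius theta : \bar R :=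
  if F (cos theta) (sin theta) == 0 then +oo%E
  else ((F (cos theta) (sin theta))^-1)%:E.

Lemma F00 : F 0 0 = 0.
Proof. by have := @FZ 2 0 0; rewrite mulr0 => /(_ ltac:(lra)); lra. Qed.

Lemma F_polar_continuous : continuous (fun theta => F (cos theta) (sin theta)).
Proof.
move=> t; apply: (@continuous_comp _ _ _ (fun t => (cos t, sin t)) (fun p => F p.1 p.2)).
  exact: (cvg_pair (@continuous_cos R t) (@continuous_sin R t)).
exact: F_continuous.
Qed.

Lemma gauge_radius_cvgy theta : F (cos theta) (sin theta) = 0 ->
  gauge_radius x @[x --> theta] --> +oo%E.
Proof.
move=> F0; apply/cvgeyPge => A.
have A0 : 0 < (`|A| + 1)^-1 by rewrite invr_gt0 ltr_wpDl.
have := cvgr_lt _ (F_polar_continuous (x := theta)) (`|A| + 1)^-1.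
rewrite F0 => /(_ _ A0); apply: filterS => t ht; rewrite /gauge_radius.
case: ifPn => [_|n0]; first exact: leey.
have p0 : 0 < F (cos t) (sin t) by rewrite lt_neqAle eq_sym n0 F_ge0.
rewrite lee_fin; apply: le_trans (_ : `|A| + 1 <= _).
  by apply: le_trans (ler_norm A) _; rewrite lerDl.
by rewrite -[leLHS]invrK lef_pV2 ?posrE // ltW.
Qed.

Lemma near_F_gt0 theta : F (cos theta) (sin theta) != 0 ->
  \forall t \near theta, 0 < F (cos t) (sin t).
Proof.
move=> n0; apply: (cvgr_gt _ (F_polar_continuous (x := theta))).
by rewrite lt_neqAle eq_sym n0 F_ge0.
Qed.

Lemma gauge_radius_cvg theta : F (cos theta) (sin theta) != 0 ->
  (F (cos x) (sin x))^-1 @[x --> theta] --> (F (cos theta) (sin theta))^-1.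
Proof. by move=> n0; apply: cvgV => //; exact: F_polar_continuous. Qed.

Lemma gauge_radius_continuous : continuous gauge_radius.
Proof.
move=> theta; rewrite /continuous_at; have [n0|n0] := eqVneq (F (cos theta) (sin theta)) 0.
  have -> : gauge_radius theta = +oo%E by rewrite /gauge_radius n0 eqxx.
  exact: gauge_radius_cvgy.
have -> : gauge_radius theta = ((F (cos theta) (sin theta))^-1)%:E.
  by rewrite /gauge_radius (negPf n0).
apply: cvg_trans (_ : (F (cos x) (sin x))^-1%:E @[x --> theta] --> _).
  apply: near_eq_cvg; have := near_F_gt0 n0; apply: filterS => t t0.
  by rewrite /gauge_radius gt_eqF.
by apply: cvg_EFin; [exact: nearW|exact: gauge_radius_cvg].
Qed.

Lemma gauge_radius_fine_continuous theta : F (cos theta) (sin theta) != 0 ->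
  {for theta, continuous (fun x => fine (gauge_radius x))}.
Proof.
move=> n0; have E : fine (gauge_radius theta) = (F (cos theta) (sin theta))^-1.
  by rewrite /gauge_radius (negPf n0).
suff : fine (gauge_radius x) @[x --> theta] --> fine (gauge_radius theta) by [].
rewrite E; apply: cvg_trans (gauge_radius_cvg n0).
apply: near_eq_cvg; have := near_F_gt0 n0; apply: filterS => t t0.
by rewrite /gauge_radius gt_eqF.
Qed.

Lemma gauge_radius_polar : polar_radius gauge_radius.
Proof.
split; last exact: gauge_radius_continuous.
- move=> t; rewrite /gauge_radius; case: ifPn => // n0.
  by rewrite lte_fin invr_gt0 lt_neqAle eq_sym n0 F_ge0.
- by move=> t; rewrite /gauge_radius mulr_natl cosD2pi sinD2pi.
Qed.

Lemma polar_point_gauge theta p :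
  polar_point (gauge_radius theta) theta = Affine p ->
  [/\ 0 < F (cos theta) (sin theta),
      p = ((F (cos theta) (sin theta))^-1 * cos theta,
           (F (cos theta) (sin theta))^-1 * sin theta) & F p.1 p.2 = 1].
Proof.
rewrite /gauge_radius; case: ifPn => //= n0 [<-] /=.
have p0 : 0 < F (cos theta) (sin theta) by rewrite lt_neqAle eq_sym n0 F_ge0.
by split=> //; rewrite FZ ?invr_gt0 // mulVf // gt_eqF.
Qed.

Lemma gauge_curve_affine p :
  polar_curve gauge_radius (Affine p) <-> F p.1 p.2 = 1.
Proof.
split; first by move=> [t _ /polar_point_gauge[]].
case: p => x y /= F1.
have [|t [r [r0 Ex Ey]]] := @polar_coordinates R x y.
  rewrite -negb_and; apply/negP => /andP[/eqP x0 /eqP y0].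
  by move: F1; rewrite x0 y0 F00 => /esym/eqP; rewrite oner_eq0.
exists t => //; move: F1; rewrite Ex Ey FZ // => rF.
have n0 : F (cos t) (sin t) != 0.
  by apply/eqP => f0; move: rF; rewrite f0 mulr0 => /esym/eqP; rewrite oner_eq0.
rewrite /gauge_radius (negPf n0) /=.
by have -> : (F (cos t) (sin t))^-1 = r by rewrite -[LHS]mul1r -rF mulfK.
Qed.

(** By homogeneity and strict superadditivity, F exceeds 1 inside a chord of the curve F = 1, so
    each ray in between meets the curve before the chord. The bound on b - a keeps the sines of the
    angle differences positive. *)
Lemma gauge_concave_part (K : R -> R -> Prop) a b : b - a < pi ->
  (forall c x y : R, 0 < c -> K x y -> K (c * x) (c * y)) ->
  (forall x y z t : R, K x y -> K z t -> 0 < x * t - y * z ->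
     F x y + F z t < F (x + z) (y + t)) ->
  (forall theta, a <= theta <= b -> K (cos theta) (sin theta)) ->
  concave_part gauge_radius a b.
Proof.
move=> bap KZ KD Kab t1 t t2 p q at1 t1t tt2 t2b.
move=> /polar_point_gauge[f1 Ep _] /polar_point_gauge[f2 Eq _].
set F1 := F _ _ in f1 Ep; set F2 := F _ _ in f2 Eq.
have K1 : K (cos t1) (sin t1) by apply: Kab; apply/andP; split; lra.
have K2 : K (cos t2) (sin t2) by apply: Kab; apply/andP; split; lra.
have det (u w : R) : cos u * sin w - sin u * cos w = sin (w - u).
  by rewrite sinB; ring.
have s12 : 0 < sin (t2 - t1) by apply: sin_gt0_pi; apply/andP; split; lra.
have s1 : 0 < sin (t - t1) by apply: sin_gt0_pi; apply/andP; split; lra.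
have s2 : 0 < sin (t2 - t) by apply: sin_gt0_pi; apply/andP; split; lra.
(* Cramer's rule for (cos t, sin t) in the basis of the two end directions. *)
pose A := sin (t2 - t) / sin (t2 - t1); pose B := sin (t - t1) / sin (t2 - t1).
have A0 : 0 < A by rewrite divr_gt0.
have B0 : 0 < B by rewrite divr_gt0.
have Ec : cos t = A * cos t1 + B * cos t2.
  rewrite /A /B -!det in s12 *; field; exact: lt0r_neq0.
have Es : sin t = A * sin t1 + B * sin t2.
  rewrite /A /B -!det in s12 *; field; exact: lt0r_neq0.
have lt : A * F1 + B * F2 < F (cos t) (sin t).
  rewrite Ec Es /F1 /F2 -!FZ //; apply: KD; try exact: KZ.
  have -> : A * cos t1 * (B * sin t2) - A * sin t1 * (B * cos t2) =
    A * B * (cos t1 * sin t2 - sin t1 * cos t2) by ring.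
  by rewrite det; apply: mulr_gt0 => //; exact: mulr_gt0.
have g0 : 0 < F (cos t) (sin t) by apply: lt_trans lt; rewrite addr_gt0 // mulr_gt0.
rewrite /gauge_radius gt_eqF //=; set g := F (cos t) (sin t) in lt g0 *.
exists (g^-1 * cos t, g^-1 * sin t) => //.
rewrite /same_side /side Ep Eq /=.
have pq : 0 < F1^-1 * F2^-1 * sin (t2 - t1) by rewrite !mulr_gt0 ?invr_gt0.
set e := _ * sin _ in pq.
set S2 := (X in _ * X); have -> : S2 = e.
  by rewrite /S2 /e -det; ring.
rewrite mulr_gt0 //; set S1 := (X in 0 < X).
(* Here e is the side of the origin; the remaining factor is positive by superadditivity. *)
have -> : S1 = e * (1 - (A * F1 + B * F2) / g).
  rewrite /S1 Ec Es /e -det; field; rewrite !lt0r_neq0 //.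
by rewrite mulr_gt0 // subr_gt0 ltr_pdivrMr // mul1r.
Qed.

End PolarGauge.

(** Angles of primitive vectors are dense and the extended reals are Hausdorff: disjoint
    neighbourhoods of two different values would still separate them at such an angle. *)
Lemma polar_radius_eq (R : realType) (rad rad' : R -> \bar R) :
  continuous rad -> continuous rad' ->
  (forall (n k : int) (l theta : R), coprimez k n -> 0 < l ->
     n%:~R = l * cos theta -> k%:~R = l * sin theta -> rad theta = rad' theta) ->
  forall theta, rad theta = rad' theta.
Proof.
move=> c c' h theta; apply/eqP; apply: contraT => ne.
have : hausdorff_space (\bar R) by exact: ereal_hausdorff.
rewrite open_hausdorff => /(_ _ _ ne) [[A B] /= [/set_mem Ax /set_mem Bx] [oA oB /eqP AB]].
have nA : \forall t \near theta, A (rad t) by apply: c; exact: open_nbhs_nbhs.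
have nB : \forall t \near theta, B (rad' t) by apply: c'; exact: open_nbhs_nbhs.
have [e /= e0 he] : nbhs_ball theta [set t | A (rad t) /\ B (rad' t)].
  by apply/nbhs_ballP; near=> t; split; near: t.
(* The cap 1 keeps the interval shorter than pi, as [rational_direction] requires. *)
pose d := Num.min (e / 2) 1.
have d0 : 0 < d by rewrite lt_min divr_gt0 //= ltr01.
have de : d < e by rewrite gt_min; apply/orP; left; lra.
have dpi : d < pi by rewrite gt_min; apply/orP; right; have := @pi_ge2 R; lra.
have [||t /andP[t1 t2] [n [k [l [co l0 En Ek]]]]] := @rational_direction R theta (theta + d).
- by rewrite ltrDl.
- by rewrite addrC addKr.
have : [set t | A (rad t) /\ B (rad' t)] t.
  by apply: he; rewrite /ball /= distrC ger0_norm; lra.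
rewrite /= -(h n k l t) // => -[At Bt].
by have : (A `&` B) (rad t) by []; rewrite AB.
Unshelve. all: by end_near.
Qed.

(** * The lattice curve *)

Lemma rational_in_ball (R : realType) (x e : R) : 0 <= x <= 1 -> 0 < e ->
  exists k n : nat, [/\ (0 < n)%N, (k <= n)%N, coprime k n &
    `|x - k%:R / n%:R| < e].
Proof.
move=> /andP[x0 x1] e0; pose N := (Num.bound e^-1).+1.
have N0 : 0 < N%:R :> R by rewrite ltr0n.
have hN : e^-1 < N%:R.
  apply: lt_trans (_ : (Num.bound e^-1)%:R < _); last by rewrite ltr_nat.
  by apply: archi_boundP; rewrite invr_ge0 ltW.
have Nx0 : 0 <= N%:R * x by rewrite mulr_ge0.
have /andP[t1 t2] := truncn_itv Nx0.
set k := Num.truncn _ in t1 t2.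
have kN : (k <= N)%N by rewrite -(ler_nat R) (le_trans t1) // ler_piMr // ltW.
have g0 : (0 < gcdn k N)%N by rewrite gcdn_gt0 orbT.
have Ek : k = (k %/ gcdn k N * gcdn k N)%N by rewrite divnK // dvdn_gcdl.
have EN : N = (N %/ gcdn k N * gcdn k N)%N by rewrite divnK // dvdn_gcdr.
exists (k %/ gcdn k N)%N, (N %/ gcdn k N)%N; split.
- by rewrite divn_gt0 // dvdn_leq // dvdn_gcdr.
- by rewrite leq_div2r.
- rewrite /coprime -(eqn_pmul2r g0) mul1n muln_gcdl -Ek -EN; exact: eqxx.
have Ek' : k%:R = (k %/ gcdn k N)%:R * (gcdn k N)%:R :> R by rewrite -natrM -Ek.
have EN' : N%:R = (N %/ gcdn k N)%:R * (gcdn k N)%:R :> R by rewrite -natrM -EN.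
have -> : (k %/ gcdn k N)%:R / (N %/ gcdn k N)%:R = k%:R / N%:R :> R.
  by rewrite Ek' EN' -mulf_div divff ?mulr1 // pnatr_eq0 -lt0n.
have -> : x - k%:R / N%:R = (N%:R * x - k%:R) / N%:R by field; rewrite lt0r_neq0.
rewrite normrM normfV !ger0_norm ?subr_ge0 ?(ltW N0) //.
rewrite ltr_pdivrMr //; apply: lt_trans (_ : 1 < _).
  by move: t2; rewrite -natr1; lra.
by rewrite -(ltr_pM2l (x := e^-1)) ?invr_gt0 // mulr1 mulrA mulVf ?mul1r // gt_eqF.
Qed.

Lemma continuous_extension_unique (R : realType) (phi : nat -> nat -> R) (Phi Psi : R -> R) :
  continuous_extension phi Phi -> continuous_extension phi Psi ->
  forall x, 0 <= x <= 1 -> Psi x = Phi x.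
Proof.
move=> [cPhi ePhi] [cPsi ePsi] x x01; apply/eqP; apply: contraT => ne.
have cD : {within `[0, 1], continuous (fun t => Psi t - Phi t)}.
  by move=> t; apply: cvgB; [exact: cPsi|exact: cPhi].
have Ax : `[0, 1]%classic x by rewrite /= in_itv.
have := cvgr_neq0 _ (cD x); rewrite subr_eq0 => /(_ _ ne).
rewrite {1}/nbhs /= -nbhs_subspace_in // => /nbhs_ballP[e /= e0 he].
have [k [n [n0 kn co xe]]] := rational_in_ball x01 e0.
have := he (k%:R / n%:R) xe; rewrite /= in_itv /= /from_subspace.
rewrite ePhi // ePsi // subrr eqxx.
apply; rewrite divr_ge0 //= ler_pdivrMr ?ltr0n // mul1r ler_nat //.
Qed.

(** Radii being positive, a point of the curve, finite or infinite, determines its angle up to full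
    turns; the lattice point therefore fixes the radius at its own angle. An arbitrary [rad] lets
    this serve both sides of the uniqueness. *)
Lemma lattice_point_radius (R : realType) (G : markov_topograph R)
    (f : int -> int -> region G) (rad : R -> \bar R) (k n : int) (l theta : R) :
  (forall x : region G, label x <= -2 \/ 2 <= label x) ->
  extends_lattice_points f rad -> coprimez k n -> 0 < l ->
  n%:~R = l * cos theta -> k%:~R = l * sin theta ->
  rad theta = if rho `|mstar f k n| == 0 then +oo%E
              else (l / rho `|mstar f k n|)%:E.
Proof.
move=> hlabel [[rad0 radP _] sub] co l0 En Ek.
have [t _] : polar_curve rad (lattice_point f k n) by apply: sub; exists k, n.
have h0 : 0 <= rho `|mstar f k n|.
  by apply: rho_ge0; apply: (vlabel_norm f hlabel (n, k)).
have El : Num.sqrt (n%:~R ^+ 2 + k%:~R ^+ 2) = l.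
  by rewrite En Ek !exprMn -mulrDr cos2Dsin2 mulr1 sqrtr_sqr gtr0_norm.
have l1 : l / l = 1 by rewrite divff // gt_eqF.
rewrite /lattice_point El En Ek; have := rad0 t.
case E : (rad t) => [r| |] //= r0; case: ifPn => // hn0 [Ec Es].
  have hp : 0 < rho `|mstar f k n| by rewrite lt_neqAle eq_sym hn0.
  rewrite lte_fin in r0; set h := rho _ in hp Ec Es *.
  have lh0 : 0 < l / h by rewrite divr_gt0.
  have Ec' : r * cos t = (l / h) * cos theta by rewrite Ec; ring.
  have Es' : r * sin t = (l / h) * sin theta by rewrite Es; ring.
  have rl : r = l / h.
    apply/eqP; rewrite -(@eqrXn2 _ 2) ?(ltW r0) ?(ltW lh0) //; apply/eqP.
    rewrite -[LHS]mulr1 -(cos2Dsin2 t) -[RHS]mulr1 -(cos2Dsin2 theta) !mulrDr.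
    by rewrite -!exprMn Ec' Es'.
  have cc : cos theta = cos t.
    by apply: (mulfI (lt0r_neq0 lh0)); rewrite -Ec' rl.
  have ss : sin theta = sin t.
    by apply: (mulfI (lt0r_neq0 lh0)); rewrite -Es' rl.
  by rewrite (periodic_angle radP cc ss) E rl.
rewrite (periodic_angle (a := theta) (b := t) radP) //.
- by rewrite Ec mulrAC l1 mul1r.
- by rewrite Es mulrAC l1 mul1r.
Qed.

Lemma sector_vectorE (p q : int * int) a b : sector_vector p q (a, b) =
  (p.1 * a%:Z + q.1 * b%:Z, p.2 * a%:Z + q.2 * b%:Z).
Proof.
have mul (u : int * int) n : u *+ n = (u.1 * n%:Z, u.2 * n%:Z).
  case: u => x y; elim: n => [|n IH]; first by rewrite mulr0n /= !mulr0.
  by rewrite mulrS IH; congr pair; rewrite /=; lia.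
by rewrite /sector_vector !mul.
Qed.

(** * The gauge of the topograph and the curve that it defines *)

Section Gauge.
Variables (R : realType) (G : markov_topograph R) (v : dart G).
Variable f : int -> int -> region G.
Hypothesis hlabel : forall x : region G, label x <= -2 \/ 2 <= label x.
Hypothesis hwell : negative_vertex_well v.
Hypothesis hfarey : farey_indexing f.
Hypothesis hcentre : centred_at f v.

Let M (p q : int * int) (w : nat * nat) : R := `|vlabel f (sector_vector p q w)|.
Let h (u : int * int) : R := rho `|vlabel f u|.

Definition gauge : R -> R -> R :=
  sector_glue (envelope (M (1, 0) (1, 1))) (envelope (M (1, 1) (0, 1)))
       (envelope (M (0, 1) (-1, 0))) (h (1, 0)) (h (1, 1)) (h (0, 1)).

Lemma well_labels : [/\ vlabel f (1, 0) <= -2, vlabel f (1, 1) <= -2 &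
  vlabel f (0, 1) <= -2].
Proof.
by case: hwell; case: hcentre => e1 e2 e3; rewrite e1 e2 e3 => *; split.
Qed.

Lemma vlabel_opp u w : coprimez w.2 w.1 -> - w = u -> vlabel f u = vlabel f w.
Proof. by move=> co <-; exact: vlabelN. Qed.

Lemma sector_labels0 : exists D, sector_labels D (M (1, 0) (1, 1)).
Proof.
have [w0 w1 w2] := well_labels; eexists; apply: (sector_labelsP hfarey hlabel) => //.
- exact: edge_pair_sector0 hcentre.
- by rewrite (@vlabel_opp _ (0, 1)).
Qed.

Lemma sector_labels1 : exists D, sector_labels D (M (1, 1) (0, 1)).
Proof.
have [w0 w1 w2] := well_labels; eexists; apply: (sector_labelsP hfarey hlabel) => //.
exact: edge_pair_sector1 hcentre.
Qed.

Lemma sector_labels2 : exists D, sector_labels D (M (0, 1) (-1, 0)).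
Proof.
have [w0 w1 w2] := well_labels; eexists; apply: (sector_labelsP hfarey hlabel) => //.
- exact: edge_pair_sector2 hcentre.
- by rewrite (@vlabel_opp _ (1, 0)).
Qed.

Lemma gauge0 : quadrant_gauge (envelope (M (1, 0) (1, 1))).
Proof. by have [D HD] := sector_labels0; exact: envelope_gauge HD. Qed.
Lemma gauge1 : quadrant_gauge (envelope (M (1, 1) (0, 1))).
Proof. by have [D HD] := sector_labels1; exact: envelope_gauge HD. Qed.
Lemma gauge2 : quadrant_gauge (envelope (M (0, 1) (-1, 0))).
Proof. by have [D HD] := sector_labels2; exact: envelope_gauge HD. Qed.

Lemma envelope_sector p q a b : (exists D, sector_labels D (M p q)) -> coprime a b ->
  envelope (M p q) a%:R b%:R =
  h (p.1 * a%:Z + q.1 * b%:Z, p.2 * a%:Z + q.2 * b%:Z).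
Proof. by move=> [D HD] co; rewrite (envelopeE HD) // /height /M sector_vectorE. Qed.

Lemma gauge_boundary :
  [/\ envelope (M (1, 0) (1, 1)) 1 0 = h (1, 0),
      envelope (M (1, 0) (1, 1)) 0 1 = h (1, 1),
      envelope (M (1, 1) (0, 1)) 1 0 = h (1, 1) &
      envelope (M (1, 1) (0, 1)) 0 1 = h (0, 1)] /\
  (envelope (M (0, 1) (-1, 0)) 1 0 = h (0, 1) /\
   envelope (M (0, 1) (-1, 0)) 0 1 = h (1, 0)).
Proof.
have s0 := sector_labels0; have s1 := sector_labels1; have s2 := sector_labels2.
split; split.
- exact: (envelope_sector (a := 1) (b := 0) s0).
- exact: (envelope_sector (a := 0) (b := 1) s0).
- exact: (envelope_sector (a := 1) (b := 0) s1).
- exact: (envelope_sector (a := 0) (b := 1) s1).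
- exact: (envelope_sector (a := 1) (b := 0) s2).
- rewrite (envelope_sector (a := 0) (b := 1) s2) // /h.
  by rewrite (@vlabel_opp _ (1, 0)).
Qed.

Lemma gaugeN x y : gauge (- x) (- y) = gauge x y.
Proof. exact: sector_glueN. Qed.

Lemma gauge_sector0 x y : sector 0 x y ->
  gauge x y = envelope (M (1, 0) (1, 1)) (x - y) y.
Proof.
case: gauge_boundary => -[e1 e2 e3 e4] [e5 e6].
exact: (sector_glue0 _ gauge0 gauge1 gauge2 e1 e2).
Qed.

Lemma gauge_sector1 x y : sector 1 x y ->
  gauge x y = envelope (M (1, 1) (0, 1)) x (y - x).
Proof.
case: gauge_boundary => -[e1 e2 e3 e4] [e5 e6].
exact: (sector_glue1 _ gauge0 gauge1 gauge2 e3 e4).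
Qed.

Lemma gauge_sector2 x y : sector 2 x y ->
  gauge x y = envelope (M (0, 1) (-1, 0)) y (- x).
Proof.
case: gauge_boundary => -[e1 e2 e3 e4] [e5 e6].
exact: (sector_glue2 _ gauge0 gauge1 gauge2 e5 e6).
Qed.

Lemma gaugeZ c x y : 0 < c -> gauge (c * x) (c * y) = c * gauge x y.
Proof.
case: gauge_boundary => -[e1 e2 e3 e4] [e5 e6].
exact: (sector_glueZ gauge0 gauge1 gauge2 e1 e2 e3 e4 e5 e6).
Qed.

Lemma gauge_ge0 x y : 0 <= gauge x y.
Proof.
case: gauge_boundary => -[e1 e2 e3 e4] [e5 e6].
exact: (sector_glue_ge0 gauge0 gauge1 gauge2 e1 e2 e3 e4 e5 e6).
Qed.

Lemma gauge_continuous : continuous (fun p : R * R => gauge p.1 p.2).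
Proof. exact: (sector_glue_continuous gauge0 gauge1 gauge2). Qed.

Lemma gaugeD_lt s x y z t : sector s x y -> sector s z t -> 0 < x * t - y * z ->
  gauge x y + gauge z t < gauge (x + z) (y + t).
Proof.
case: gauge_boundary => -[e1 e2 e3 e4] [e5 e6].
exact: (sector_glueD_lt gauge0 gauge1 gauge2 e1 e2 e3 e4 e5 e6).
Qed.

Lemma gauge_eq0 x y : gauge x y = 0 -> [|| x == 0, y == 0 | x == y].
Proof.
case: gauge_boundary => -[e1 e2 e3 e4] [e5 e6].
exact: (sector_glue_eq0 gauge0 gauge1 gauge2 e1 e2 e3 e4 e5 e6).
Qed.

(** Evenness leaves k >= 0; the three sectors then write the vector (n, k) in their own bases as (n
    - k, k), (n, k - n) or (k, - n), where the envelope agrees with the height. *)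
Lemma gauge_lattice (k n : int) : coprimez k n ->
  gauge n%:~R k%:~R = rho `|mstar f k n|.
Proof.
wlog k0 : k n / 0 <= k.
  move=> wl co; case: (lerP 0 k) => k0; first exact: wl.
  rewrite -gaugeN -!mulrNz wl ?oppr_ge0 ?(ltW k0) ?coprimeNz ?coprimezN //.
  by rewrite /mstar farey_opp.
case: k k0 => // k _ co; case: (lerP 0 n) => n0; last first.
  case: n n0 co => // n _ co.
  rewrite gauge_sector2 ?NegzE; last first.
    by apply/andP; split; rewrite ?ler0z ?lerz0.
  rewrite mulrNz opprK (envelope_sector sector_labels2) //.
  by rewrite /h /vlabel /=; congr (rho `|mstar f _ _|); lia.
case: n n0 co => // n _ co; have co' : coprime k n by [].
case: (leqP k n) => [kn|/ltnW nk].
- rewrite gauge_sector0; last by apply/andP; split; rewrite ?ler0z ?ler_int.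
  rewrite -[_ - _]/(n%:R - k%:R) -natrB // (envelope_sector sector_labels0).
    by rewrite /h /vlabel /=; congr (rho `|mstar f _ _|); lia.
  by rewrite coprime_subl // coprime_sym.
- rewrite gauge_sector1; last by apply/andP; split; rewrite ?ler0z ?ler_int.
  rewrite -[_ - _]/(k%:R - n%:R) -natrB // (envelope_sector sector_labels1).
    by rewrite /h /vlabel /=; congr (rho `|mstar f _ _|); lia.
  by rewrite coprime_sym coprime_subl.
Qed.

Lemma gauge_norm c x y : gauge (c * x) (c * y) = `|c| * gauge x y.
Proof.
case: (ltrgt0P c) => [c0|c0|->]; first exact: gaugeZ.
- by rewrite -gaugeN -!mulNr gaugeZ // oppr_gt0.
- by rewrite !mul0r; have := @gaugeZ 2 0 0; rewrite !mulr0 => /(_ ltac:(lra)); lra.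
Qed.

(** The gauge is positive inside the sectors, so its zeros lie on the three lines. On such a line it
    is a multiple of the height of the central region, which vanishes only for the label -2, the
    well excluding 2. *)
Lemma gauge_special theta :
  special_angle f theta <-> gauge (cos theta) (sin theta) = 0.
Proof.
have [w0 w1 w2] := well_labels.
have zero (k n : int) : coprimez k n -> mstar f k n = -2 -> gauge n%:~R k%:~R = 0.
  by move=> co E; rewrite gauge_lattice // E normrN ger0_norm // rho2.
have tight (k n : int) : coprimez k n -> mstar f k n <= -2 ->
    gauge n%:~R k%:~R = 0 -> mstar f k n = -2.
  move=> co le; rewrite gauge_lattice // => /rho_eq0.
  by rewrite ler0_norm; [move=> /(_ ltac:(lra)); lra|lra].
have cs := cos2Dsin2 theta; split.
- move=> [k [n [kn mkn]]]; rewrite /has_slope; move: kn mkn.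
  rewrite !inE => /or3P[] /eqP[-> ->] mkn.
  + rewrite mulr0 mulr1 => E; rewrite -E -[X in gauge X _](mulr0 (sin theta)).
    by rewrite -[X in gauge _ X]mulr1 gauge_norm (zero 1 0) // mulr0.
  + rewrite !mulr1 => ->; rewrite -[cos theta]mulr1.
    by rewrite gauge_norm (zero 1 1) // mulr0.
  + rewrite mulr0 mulr1 => ->; rewrite -[X in gauge _ X](mulr0 (cos theta)).
    by rewrite -[X in gauge X _]mulr1 gauge_norm (zero 0 1) // mulr0.
- move=> g0; have /or3P[/eqP c0|/eqP s0|/eqP cs0] := gauge_eq0 g0.
  + exists 1, 0; split; [by []| |by rewrite /has_slope c0 mulr0 mul0r].
    apply: tight => //; move/eqP: g0; rewrite c0 -[X in gauge X _](mulr0 (sin theta)).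
    rewrite -[X in gauge _ X]mulr1 gauge_norm mulf_eq0 normr_eq0 => /orP[/eqP s0|/eqP//].
    by move/eqP: cs; rewrite c0 s0 !expr0n /= addr0 eq_sym oner_eq0.
  + exists 0, 1; split; [by []| |by rewrite /has_slope s0 mulr0 mul0r].
    apply: tight => //; move/eqP: g0; rewrite s0 -[X in gauge _ X](mulr0 (cos theta)).
    rewrite -[X in gauge X _]mulr1 gauge_norm mulf_eq0 normr_eq0 => /orP[/eqP c0|/eqP//].
    by move/eqP: cs; rewrite c0 s0 !expr0n /= addr0 eq_sym oner_eq0.
  + exists 1, 1; split; [by []| |by rewrite /has_slope cs0].
    apply: tight => //; move/eqP: g0; rewrite -cs0 -[cos theta]mulr1.
    rewrite gauge_norm mulf_eq0 normr_eq0 => /orP[/eqP c0|/eqP//].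
    by move/eqP: cs; rewrite -cs0 c0 !expr0n /= addr0 eq_sym oner_eq0.
Qed.

Definition direction (i : 'I_4) (x : R) : R * R :=
  match val i with
  | 0%N => (x, 1)
  | 1%N => (1, x)
  | 2%N => (- 1, x)
  | _ => (x, - 1)
  end.

(** By homogeneity, dividing by n moves a lattice vector to the square max(|x|, |y|) = 1, which the
    four [direction] segments and their opposites cover. *)
Definition encoding (i : 'I_4) (x : R) : R :=
  gauge (direction i x).1 (direction i x).2.

Lemma encoding_extension i : continuous_extension (phi f i) (encoding i).
Proof.
have cont (g k : R -> R) : continuous g -> continuous k ->
    {within `[0, 1], continuous (fun x => gauge (g x) (k x))}.
  move=> cg ck; apply: continuous_subspaceT => x.
  apply: (@continuous_comp _ _ _ (fun x => (g x, k x)) (fun p => gauge p.1 p.2)).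
    exact: (cvg_pair (cg x) (ck x)).
  exact: gauge_continuous.
have cid : continuous (fun x : R => x) by move=> x; exact: cvg_id.
have ccst c : continuous (fun _ : R => c : R) by move=> x; exact: cvg_cst.
split.
- case: i => [[|[|[|[|//]]]] i4] /=; rewrite /encoding /direction /=; exact: cont.
move=> k n n0 kn co.
have nR : 0 < (n%:R : R)^-1 by rewrite invr_gt0 ltr0n.
have n1 : n%:R^-1 * n%:R = 1 :> R by rewrite mulVf // pnatr_eq0 -lt0n.
have E (a b : int) : coprimez b a ->
    gauge (n%:R^-1 * a%:~R) (n%:R^-1 * b%:~R) = rho `|mstar f b a| / n%:R.
  by move=> co'; rewrite gaugeZ // gauge_lattice // mulrC.
case: i => [[|[|[|[|//]]]] i4] /=; rewrite /encoding /direction /phi /= [k%:R / _]mulrC.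
- by rewrite -[X in gauge _ X]n1 (E k n) // coprimezE coprime_sym.
- by rewrite -[X in gauge X _]n1 (E n k).
- rewrite -gaugeN opprK -mulrN -[X in gauge X _]n1.
  by have := E n (- k%:Z); rewrite coprimeNz mulrNz; apply.
- have -> : -1 = n%:R^-1 * - n%:R :> R by rewrite mulrN n1.
  by have := E k (- n%:Z); rewrite coprimeNz mulrNz coprimez_sym; apply.
Qed.

(** The converse scales a point of gauge 1 by its larger coordinate onto the square: comparing |x|
    with |y| and the sign of the ratio select the segment, and the sign of the larger coordinate
    then decides between it and its opposite. *)
Lemma encoding_curve p : gauge p.1 p.2 = 1 <-> lattice_curve encoding p.
Proof.
have NZ (c : R) (x y : R) : gauge x y = c -> c != 0 -> gauge (x / c) (y / c) = 1.
  move=> g n0; have c0 : 0 < c by rewrite lt_neqAle eq_sym n0 -g gauge_ge0.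
  by rewrite ![_ / c]mulrC gaugeZ ?invr_gt0 // g mulVf.
split; last first.
  have half (i : 'I_4) x : encoding i x != 0 ->
      gauge ((direction i x).1 / encoding i x) ((direction i x).2 / encoding i x) = 1.
    exact: NZ.
  case=> [[i [x [x01 n0 ->]]]|[_ [i [x [x01 n0 ->]]] <-]] /=.
    exact: half.
  by rewrite gaugeN; exact: half.
case: p => x y /= g1.
pose half q := exists (i : 'I_4) (t : R), [/\ 0 <= t <= 1, encoding i t != 0 &
  q = ((direction i t).1 / encoding i t, (direction i t).2 / encoding i t)].
suff : half (x, y) \/ half (- x, - y).
  case=> hf; [by left|right; exists (- x, - y) => //].
  by congr pair; rewrite /= opprK.
have ratio (a b : R) : a != 0 -> `|b| <= `|a| -> `|b / a| <= 1.
  by move=> a0 ba; rewrite normrM normfV ler_pdivrMr ?normr_gt0 // mul1r.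
have scaled (i : 'I_4) (c d1 d2 t : R) : direction i t = (d1, d2) ->
    0 <= t <= 1 -> 0 < c -> gauge (c * d1) (c * d2) = 1 -> half (c * d1, c * d2).
  move=> Ed t01 c0; rewrite gaugeZ // => cg.
  have gc : encoding i t = c^-1.
    by rewrite /encoding Ed -[LHS]mul1r -(mulVf (lt0r_neq0 c0)) -mulrA cg mulr1.
  exists i, t; split=> //; first by rewrite gc invr_neq0 // lt0r_neq0.
  by rewrite gc Ed invrK /= ![_ * c]mulrC.
have pick (a b : R) : a != 0 -> a * (b / a) = b by move=> a0; rewrite mulrC divfK.
case: (lerP `|y| `|x|) => [yx|/ltW xy].
- have x0 : x != 0.
    apply/eqP => x0; move: yx g1; rewrite x0 normr0 normr_le0 => /eqP ->.
    have := gauge_norm 0 0 0; rewrite !mul0r normr0 mul0r => -> /esym/eqP.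
    by rewrite oner_eq0.
  have /ler_normlP[t1 t2] := ratio _ _ x0 yx.
  case: (lerP 0 (y / x)) => t0.
  + have hf c : 0 < c -> gauge (c * 1) (c * (y / x)) = 1 -> half (c * 1, c * (y / x)).
      by apply: (scaled (inord 1) _ _ _ (y / x)); [rewrite /direction /= inordK|rewrite t0 t2].
    case: (ltrgt0P x) => xs; last by rewrite xs eqxx in x0.
    * by left; have := hf x xs; rewrite mulr1 pick //; apply.
    * right; have := hf (- x); rewrite oppr_gt0 mulr1 mulNr pick //.
      by rewrite gaugeN => /(_ xs g1).
  + have hf c : 0 < c -> gauge (c * (-1)) (c * - (y / x)) = 1 ->
        half (c * (-1), c * - (y / x)).
      by apply: (scaled (inord 2) _ _ _ (- (y / x)));
        [rewrite /direction /= inordK|rewrite oppr_ge0 (ltW t0)].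
    case: (ltrgt0P x) => xs; last by rewrite xs eqxx in x0.
    * right; have := hf x xs; rewrite mulrN1 mulrN pick // gaugeN; exact.
    * left; have := hf (- x); rewrite oppr_gt0 mulrN1 opprK mulrNN pick //.
      by move=> /(_ xs g1).
- have y0 : y != 0.
    apply/eqP => y0; move: xy g1; rewrite y0 normr0 normr_le0 => /eqP ->.
    have := gauge_norm 0 0 0; rewrite !mul0r normr0 mul0r => -> /esym/eqP.
    by rewrite oner_eq0.
  have /ler_normlP[t1 t2] := ratio _ _ y0 xy.
  case: (lerP 0 (x / y)) => t0.
  + have hf c : 0 < c -> gauge (c * (x / y)) (c * 1) = 1 -> half (c * (x / y), c * 1).
      by apply: (scaled (inord 0) _ _ _ (x / y)); [rewrite /direction /= inordK|rewrite t0 t2].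
    case: (ltrgt0P y) => ys; last by rewrite ys eqxx in y0.
    * by left; have := hf y ys; rewrite mulr1 pick //; apply.
    * right; have := hf (- y); rewrite oppr_gt0 mulr1 mulNr pick //.
      by rewrite gaugeN => /(_ ys g1).
  + have hf c : 0 < c -> gauge (c * - (x / y)) (c * (-1)) = 1 ->
        half (c * - (x / y), c * (-1)).
      by apply: (scaled (inord 3) _ _ _ (- (x / y)));
        [rewrite /direction /= inordK|rewrite oppr_ge0 (ltW t0)].
    case: (ltrgt0P y) => ys; last by rewrite ys eqxx in y0.
    * right; have := hf y ys; rewrite mulrN1 mulrN pick // gaugeN; exact.
    * left; have := hf (- y); rewrite oppr_gt0 mulrN1 opprK mulrNN pick //.
      by move=> /(_ ys g1).
Qed.

Lemma gauge_radius_extends : extends_lattice_points f (gauge_radius gauge).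
Proof.
split; first exact: (gauge_radius_polar gauge_ge0 gauge_continuous).
move=> _ [k [n [co ->]]]; have [|t [l [l0 En Ek]]] := @polar_coordinates R n%:~R k%:~R.
  rewrite !intr_eq0 -negb_and; apply/negP => /andP[/eqP n0 /eqP k0].
  by move: co; rewrite n0 k0.
exists t => //; have gl : l * gauge (cos t) (sin t) = rho `|mstar f k n|.
  by rewrite -gaugeZ // -En -Ek gauge_lattice.
have El : Num.sqrt (n%:~R ^+ 2 + k%:~R ^+ 2) = l.
  by rewrite En Ek !exprMn -mulrDr cos2Dsin2 mulr1 sqrtr_sqr gtr0_norm.
have ln0 := lt0r_neq0 l0.
rewrite /lattice_point El -gl mulf_eq0 (negPf ln0) /= /gauge_radius.
case: ifPn => [_|n0] /=.
  by rewrite En Ek ![l * _]mulrC !mulfK.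
by rewrite En Ek; congr (Affine (_, _)); field; rewrite n0.
Qed.

Lemma gauge_six_parts i : (i < 6)%N ->
  concave_part (gauge_radius gauge)
    (nth 0 (sector_angles R) i) (nth 0 (sector_angles R) i.+1).
Proof.
have p0 := @pi_gt0 R.
have scale s c x y : 0 < c -> sector s x y -> sector s (c * x) (c * y).
  by move=> c0; case: s => [|[|s]] /andP[? ?]; apply/andP;
    rewrite ?pmulr_rge0 ?pmulr_rle0 ?ler_pM2l.
have part s a b : b - a < pi ->
    (forall t, a <= t <= b -> sector s (cos t) (sin t)) ->
    concave_part (gauge_radius gauge) a b.
  move=> ab; apply: (gauge_concave_part gaugeZ gauge_ge0 ab).
  - by move=> *; exact: scale.
  - exact: gaugeD_lt.
(* The gauge is invariant under the half turn, which carries each upper part to a lower one. *)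
have part' s a b : b - a < pi ->
    (forall t, a <= t <= b -> sector s (cos t) (sin t)) ->
    concave_part (gauge_radius gauge) (pi + a) (pi + b).
  move=> ab sec; apply: (gauge_concave_part (K := fun x y => sector s (- x) (- y))
      gaugeZ gauge_ge0) => //; first by lra.
  - by move=> c x y c0 ?; rewrite -!mulrN; exact: scale.
  - move=> x y z t S T xt; rewrite -(gaugeN x) -(gaugeN z) -(gaugeN (x + z)) !opprD.
    by apply: gaugeD_lt S T _; rewrite !mulrNN.
  - move=> t /andP[t1 t2]; have := sec (t - pi).
    have -> : cos t = - cos (t - pi) by rewrite -cosDpi subrK.
    have -> : sin t = - sin (t - pi) by rewrite -sinDpi subrK.
    by rewrite !opprK; apply; apply/andP; split; lra.
have s0 (t : R) : 0 <= t <= pi / 4 -> sector 0 (cos t) (sin t).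
  move=> t01; rewrite /sector sin_le_cos // andbT sin_ge0_pi //.
  by case/andP: t01 => ? ?; apply/andP; split; lra.
have s1 (t : R) : pi / 4 <= t <= pi / 2 -> sector 1 (cos t) (sin t).
  move=> t01; rewrite /sector cos_le_sin // andbT cos_ge0_pihalf //.
  by case/andP: t01 => ? ?; apply/andP; split; lra.
have s2 (t : R) : pi / 2 <= t <= pi -> sector 2 (cos t) (sin t).
  move=> t01; rewrite /sector cos_le0 //= sin_ge0_pi //.
  by case/andP: t01 => ? ?; apply/andP; split; lra.
case: i => [|[|[|[|[|[|//]]]]]] _ /=.
- by apply: (part 0%N) => //; lra.
- by apply: (part 1%N) => //; lra.
- by apply: (part 2%N) => //; lra.
- by rewrite -[X in concave_part _ X _]addr0; apply: (part' 0%N) => //; lra.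
- by apply: (part' 1%N) => //; lra.
- have -> : 2 * pi = pi + pi :> R by ring.
  by apply: (part' 2%N) => //; lra.
Qed.

End Gauge.

Theorem theorem11p6 (R : realType) (G : markov_topograph R) (v : dart G)
    (f : int -> int -> region G)
    (hlabel : forall x : region G, label x <= -2 \/ 2 <= label x)
    (hwell : negative_vertex_well v)
    (hfarey : farey_indexing f)
    (hcentre : centred_at f v) :
  (forall d : dart G, 20 <= discriminator d) /\
  exists Phi : 'I_4 -> R -> R,
    [/\ forall i : 'I_4, continuous_extension (phi f i) (Phi i),
        forall (i : 'I_4) (Psi : R -> R),
          continuous_extension (phi f i) Psi ->
          forall x : R, 0 <= x <= 1 -> Psi x = Phi i x &
        exists rad : R -> \bar R,
          [/\ extends_lattice_points f rad,
              forall rad' : R -> \bar R,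
                extends_lattice_points f rad' ->
                forall theta : R, rad' theta = rad theta,
              [set p : R * R | polar_curve rad (Affine p)] =
                lattice_curve Phi,
              forall i : nat, (i < 6)%N ->
                concave_part rad (nth 0 (sector_angles R) i)
                  (nth 0 (sector_angles R) i.+1) &
              forall theta : R,
                (special_angle f theta ->
                   rad theta = +oo%E /\
                   rad x @[x --> theta^'] --> +oo%E) /\
                (~ special_angle f theta ->
                   rad theta \is a fin_num /\
                   {for theta, continuous (fun x => fine (rad x))})]].
Proof.
split; first by move=> d; exact: discriminator_well hwell.
have gZ := gaugeZ hlabel hwell hfarey hcentre.
have g0 := gauge_ge0 hlabel hwell hfarey hcentre.
have gc := gauge_continuous hlabel hwell hfarey hcentre.
have ext := encoding_extension hlabel hwell hfarey hcentre.
have rad_ext := gauge_radius_extends hlabel hwell hfarey hcentre.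
exists (encoding f); split=> //.
  by move=> i Psi; exact: continuous_extension_unique.
exists (gauge_radius (gauge f)); split=> //.
(* The lattice points force both radii at the angles of primitive vectors. *)
- move=> rad' ext'; apply: polar_radius_eq.
  + by case: ext' => -[].
  + by case: rad_ext => -[].
  + move=> n k l t co l0 En Ek.
    by rewrite (lattice_point_radius hlabel ext' co l0 En Ek)
      (lattice_point_radius hlabel rad_ext co l0 En Ek).
- apply/seteqP; split=> p /=.
  + by move=> /(gauge_curve_affine gZ g0) /(encoding_curve hlabel hwell hfarey hcentre).
  + by move=> /(encoding_curve hlabel hwell hfarey hcentre) /(gauge_curve_affine gZ g0).
- exact: gauge_six_parts hlabel hwell hfarey hcentre.
move=> theta; have spec := gauge_special hlabel hwell hfarey hcentre theta.
split=> [/spec E|nspec].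
- split; first by rewrite /gauge_radius E eqxx.
  apply: cvg_trans (gauge_radius_cvgy g0 gc E).
  exact/cvg_app/cvg_within.
- have n0 : gauge f (cos theta) (sin theta) != 0 by apply/eqP => /spec.
  split; first by rewrite /gauge_radius (negPf n0).
  exact: (gauge_radius_fine_continuous g0 gc n0).
Qed.
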